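(* Fix $p\ge 1$, a tail index $\kappa\in(2,4)$, a skewness parameter $\alpha\in\mathbb{R}$, and a $p\times p$ correlation matrix $R$. Let $X_1,X_2,\dots$ be i.i.d. copies of the $\mathbb{R}^p$-valued random vector $X$ of the skew-$t$/$t$-copula model with parameters $(\kappa,\alpha,R)$, let $\Sigma=\operatorname{Cov}(X)$, assumed positive definite, and let $$\widehat{\Sigma}=\widehat{\Sigma}_n=\frac1n\sum_{t=1}^n (X_t-\bar X)(X_t-\bar X)^{\top},\qquad \bar X=\frac1n\sum_{t=1}^nX_t,$$ be the centred sample covariance. Then, as $n\to\infty$, $$\|\widehat{\Sigma}-\Sigma\|_2=O_P\big(n^{-(\kappa-2)/\kappa}\big),$$ and consequently $$\mathcal{R}(\widehat{\Sigma})=O_P\big(n^{-2(\kappa-2)/\kappa}\big).$$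
   Context: Model: let $\nu=\kappa$, let $W\sim\chi^2_\nu/\nu$ (a chi-squared variable with $\nu$ degrees of freedom divided by $\nu$) and $Z\sim N(0,R)$ be independent, where $R$ is a $p\times p$ correlation matrix, and set $T=Z/\sqrt{W}$ (a multivariate-$t$ vector). With $\delta=\alpha/\sqrt{1+\alpha^2}$, the vector $X=(X^{(1)},\dots,X^{(p)})$ has coordinates $$X^{(i)}=\delta\,|T_i|+\sqrt{1-\delta^2}\,T_i,\qquad i=1,\dots,p.$$ Regret: $\mathbf{1}\in\mathbb{R}^p$ is the all-ones vector. For a symmetric positive definite $S$, the global minimum-variance portfolio is $w(S)=\arg\min_{x:\mathbf{1}^{\top}x=1}x^{\top}Sx=S^{-1}\mathbf{1}/(\mathbf{1}^{\top}S^{-1}\mathbf{1})$. The regret of a positive definite $\widehat{\Sigma}$ relative to $\Sigma$ is $\mathcal{R}(\widehat{\Sigma})=w(\widehat{\Sigma})^{\top}\Sigma\,w(\widehat{\Sigma})-w(\Sigma)^{\top}\Sigma\,w(\Sigma)$. It is defined on the event that $\widehat{\Sigma}$ is positive definite, so the second $O_P$ statement is understood on that event (outside it $\mathcal{R}$ may be assigned any value). $\|\cdot\|_2$ on matrices is the spectral norm. $Y_n=O_P(a_n)$ means that for every $\varepsilon>0$ there are $M,N$ with $\mathbb{P}(|Y_n|>Ma_n)\le\varepsilon$ for all $n\ge N$. *)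

(* Defs.v *)
From HB Require Import structures.
From mathcomp Require Import all_boot all_order all_algebra finmap.
From mathcomp Require Import all_classical all_reals all_analysis.

Set Implicit Arguments.
Unset Strict Implicit.
Unset Printing Implicit Defensive.

Import Order.TTheory GRing.Theory Num.Theory.
Import numFieldNormedType.Exports.

Local Open Scope classical_set_scope.
Local Open Scope ring_scope.

Section LinearAlgebra.
Context {R : realType} {p : nat}.

Definition qform (S : 'M[R]_p) (x : 'cV[R]_p) : R := (x^T *m S *m x) 0 0.

Definition posdefmx (S : 'M[R]_p) : Prop :=
  S^T = S /\ forall x : 'cV[R]_p, x != 0 -> 0 < qform S x.

Definition correlation_mx (S : 'M[R]_p) : Prop :=
  [/\ S^T = S, forall x : 'cV[R]_p, 0 <= qform S x & forall i, S i i = 1].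

Definition enorm (x : 'cV[R]_p) : R := Num.sqrt (\sum_i x i 0 ^+ 2).

(* The norm that MathComp-Analysis puts on matrices is the entrywise maximum,
   hence this operator norm for the Euclidean norm. *)
Definition spectral_norm (A : 'M[R]_p) : R :=
  sup [set enorm (A *m x) | x in [set x : 'cV[R]_p | enorm x <= 1]].

Definition ones : 'cV[R]_p := const_mx 1.

Definition gmv_minimizer (S : 'M[R]_p) : set 'cV[R]_p :=
  [set x | ones^T *m x = 1%:M /\
           forall y : 'cV[R]_p, ones^T *m y = 1%:M -> qform S x <= qform S y].

(* The value 0 is used only if there is no minimizer; for a positive definite
   [S] and [0 < p] the minimizer exists and is unique, see [gmvE]. *)
Definition gmv (S : 'M[R]_p) : 'cV[R]_p := xget 0 (gmv_minimizer S).

Definition regret (Sigma S : 'M[R]_p) : R :=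
  qform Sigma (gmv S) - qform Sigma (gmv Sigma).

Definition sample_mean (x : nat -> 'cV[R]_p) (n : nat) : 'cV[R]_p :=
  n%:R^-1 *: \sum_(t < n) x t.

Definition sample_cov (x : nat -> 'cV[R]_p) (n : nat) : 'M[R]_p :=
  n%:R^-1 *: \sum_(t < n)
     (x t - sample_mean x n) *m (x t - sample_mean x n)^T.

Lemma posdefmx_unit (S : 'M[R]_p) : posdefmx S -> S \in unitmx.
Proof.
move=> [St Spos]; rewrite -row_free_unit -kermx_eq0.
apply/eqP/row_matrixP => i; rewrite row0; apply/eqP/negPn/negP => k0.
have kT0 : (row i (kermx S))^T != 0 by rewrite -trmx0 (inj_eq trmx_inj).
have := Spos _ kT0.
by rewrite /qform trmxK -row_mul mulmx_ker row0 mul0mx mxE ltxx.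
Qed.


Lemma gmv_split (S : 'M[R]_p) (x y : 'cV[R]_p) :
  posdefmx S -> S *m x = (qform S x) *: ones ->
  ones^T *m x = 1%:M -> ones^T *m y = 1%:M ->
  qform S y = qform S x + qform S (y - x).
Proof.
move=> [St Spos] Sx x1 y1.
have xS : x^T *m S = qform S x *: ones^T.
  by rewrite -[LHS]trmxK trmx_mul St trmxK Sx linearZ.
have cross : x^T *m S *m (y - x) = 0.
  by rewrite xS -scalemxAl mulmxBr x1 y1 subrr scaler0.
have cross' : (y - x)^T *m S *m x = 0.
  apply: (can_inj (@trmxK _ _ _)).
  by rewrite trmx0 trmx_mul trmx_mul trmxK St mulmxA cross.
have -> : qform S y = qform S (x + (y - x)) by rewrite subrKC.
move: (y - x : 'cV_p) cross cross' => h cross cross'.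
have xhT : (x + h)^T = x^T + h^T by apply/matrixP => i j; rewrite !mxE.
rewrite /qform xhT mulmxDl mulmxDl !mulmxDr.
by rewrite cross cross' addr0 add0r mxE.
Qed.

Lemma gmvE (S : 'M[R]_p) : (0 < p)%N -> posdefmx S ->
  gmv S = ((ones^T *m invmx S *m ones) 0 0)^-1 *: (invmx S *m ones).
Proof.
move=> p0 Spd; have Su := posdefmx_unit Spd; have [St Spos] := Spd.
set c := (_ *m _ *m _) 0 0; set v := invmx S *m ones.
have v0 : v != 0.
  apply/eqP => v0; have : S *m v = ones by rewrite mulmxA mulmxV ?mul1mx.
  rewrite v0 mulmx0 => /matrixP/(_ (Ordinal p0) 0); rewrite !mxE => /eqP.
  by rewrite eq_sym oner_eq0.
have cE : ones^T *m v = c%:M by rewrite [LHS]mx11_scalar /v mulmxA.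
have Sv : S *m v = ones by rewrite mulmxA mulmxV ?mul1mx.
have vc : qform S v = c.
  rewrite /qform -mulmxA Sv -[_ *m _]trmxK trmx_mul trmxK cE.
  by rewrite tr_scalar_mx !mxE.
have c0 : 0 < c by rewrite -vc Spos.
have cn0 : c != 0 by rewrite gt_eqF.
set w := c^-1 *: v.
have w1 : ones^T *m w = 1%:M.
  by rewrite -scalemxAr cE scale_scalar_mx mulVf.
have wc : qform S w = c^-1.
  rewrite /qform -mulmxA -scalemxAr Sv -scalemxAr.
  rewrite -[w^T *m ones]trmxK trmx_mul trmxK w1.
  by rewrite tr_scalar_mx !mxE eqxx mulr1n mulr1.
have Sw : S *m w = qform S w *: ones by rewrite -scalemxAr Sv wc.
have split y := gmv_split Spd Sw w1 (y := y).
apply: xget_unique => /=.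
- split=> // y y1; rewrite (split y y1) lerDl.
  by have [->|/Spos/ltW//] := eqVneq (y - w) 0; rewrite /qform mulmx0 mxE.
- move=> y [y1 ymin]; apply/eqP; rewrite -subr_eq0; apply/negPn/negP => /Spos.
  by rewrite ltNge => /negP; apply; rewrite -(gerDl (qform S w)) -split// ymin.
Qed.

End LinearAlgebra.

Section Laws.
Context {R : realType}.
Local Notation mu := (@lebesgue_measure R).

Definition Gamma (s : R) : R :=
  \int[mu]_(x in `]0, +oo[) (x `^ (s - 1) * expR (- x)).

Definition chi2_pdf (nu x : R) : R :=
  if 0 < x then
    x `^ (nu / 2 - 1) * expR (- x / 2) / (2 `^ (nu / 2) * Gamma (nu / 2))
  else 0.

Definition chi2_prob (nu : R) (A : set R) : \bar R :=
  (\int[mu]_(x in A) (chi2_pdf nu x)%:E)%E.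

(* [normal_prob m s] takes the standard deviation [s] and is a junk value (a
   uniform law) for [s = 0], where N(0, 0) is the Dirac mass at 0. *)
Definition centered_normal (v : R) (A : set R) : \bar R :=
  if v == 0 then dirac (0 : R) A else normal_prob 0 (Num.sqrt v) A.

Definition col_of_tuple p (t : p.-tuple R) : 'cV[R]_p := \col_i tnth t i.

End Laws.

Section RandomVectors.
Context {R : realType} {d : measure_display} {Omega : measurableType d}.
Variable P : probability Omega R.

Definition has_law d' (E : measurableType d') (X : Omega -> E)
    (m : set E -> \bar R) : Prop :=
  forall A, measurable A -> P (X @^-1` A) = m A.

(* N(0, S) for a possibly singular covariance matrix [S]. *)
Definition gaussian_vector p (S : 'M[R]_p) (Z : Omega -> p.-tuple R) : Prop :=
  forall a : 'cV[R]_p,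
    has_law (fun w => (a^T *m col_of_tuple (Z w)) 0 0 : R)
            (centered_normal (qform S a)).

Definition independent2 d1 d2 (E1 : measurableType d1) (E2 : measurableType d2)
    (X : Omega -> E1) (Y : Omega -> E2) : Prop :=
  forall A B, measurable A -> measurable B ->
    (P ((X @^-1` A) `&` (Y @^-1` B)) = P (X @^-1` A) * P (Y @^-1` B))%E.

Definition mutually_independent d' (E : measurableType d')
    (X : nat -> Omega -> E) : Prop :=
  forall (J : {fset nat}) (B : nat -> set E), (forall t, measurable (B t)) ->
    P (\bigcap_(t in [set` J]) (X t @^-1` B t)) =
    (\prod_(t <- J) P (X t @^-1` B t))%E.

Definition stoch_bigO (Y : nat -> Omega -> R) (a : nat -> R) : Prop :=
  forall eps : R, 0 < eps -> exists (M : R) (N : nat), forall n, (N <= n)%N ->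
    (P [set w | (M * a n < `|Y n w|)%R] <= eps%:E)%E.

Definition cov_mx p (X : Omega -> p.-tuple R) : 'M[R]_p :=
  \matrix_(i, j) fine (covariance P (fun w => tnth (X w) i)
                                    (fun w => tnth (X w) j)).

End RandomVectors.

Section SkewT.
Context {R : realType} {d : measure_display} {Omega : measurableType d}.
Variables (P : probability Omega R) (p : nat).

(* The first clause says that [W] is a chi-squared variable with [kappa] degrees
   of freedom divided by [kappa]. *)
Definition skew_t_data (kappa : R) (Rho : 'M[R]_p)
    (W : {RV P >-> R}) (Z : {RV P >-> p.-tuple R}) : Prop :=
  [/\ has_law P (fun w => kappa * W w : R) (chi2_prob kappa),
      gaussian_vector P Rho Z &
      independent2 P W Z].

Definition skew_t_vector (alpha : R) (W : Omega -> R) (Z : Omega -> p.-tuple R)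
    (w : Omega) : p.-tuple R :=
  let delta := alpha / Num.sqrt (1 + alpha ^+ 2) in
  let T i := tnth (Z w) i / Num.sqrt (W w) in
  [tuple delta * `|T i| + Num.sqrt (1 - delta ^+ 2) * T i | i < p].

End SkewT.

(* Main.v *)
(** A coordinate of [X] is at most a constant times [|Z_i| / sqrt W].  The
    density of [W] is of order [w^(kappa/2 - 1)] at [0] and [Z_i] has Gaussian
    tails, so conditioning on the integer part of [|Z_i|] gives
    [P(|X_i| > s) <= C s^(-kappa)], hence tails of index [kappa/2] in [(1, 2)]
    for the products [X_i X_j].  Means of [n] pairwise independent, identically
    distributed variables with tail index [a] in [(1, 2)] are within
    [O_P(n^(1/a - 1))] of their expectation: truncate at [K n^(1/a)], bound the
    bias and the variance of the truncated variables by geometric series over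
    dyadic levels, and use Chebyshev.  For [a = kappa/2] this is the rate of the
    theorem, for the entries of the sample second moments and also, crudely, for
    the sample means.

    For the regret write [h] for the difference of the two portfolios and [E] for
    the error matrix.  Since [1^T h = 0], the optimality conditions give
    [h^T Sigma h = - h^T E (w + h)].  The left side is the regret, and [|h|] is
    of the order of its square root, so the regret is of order [|E|^2]. *)
Require Import Defs.
From HB Require Import structures.
From mathcomp Require Import all_boot all_order all_algebra finmap.
From mathcomp Require Import all_classical all_reals all_analysis.
From mathcomp Require Import measurable_realfun ring lra.

Set Implicit Arguments.
Unset Strict Implicit.
Unset Printing Implicit Defensive.

Import Order.TTheory GRing.Theory Num.Theory.
Import numFieldNormedType.Exports.

Local Open Scope classical_set_scope.
Local Open Scope ring_scope.

(** * Moments from tail bounds *)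

Lemma nneseries_le_geometric (R : realType) (u : nat -> \bar R) (B q : R) :
  0 <= B -> 0 <= q < 1 -> (forall k, (0 <= u k <= (B * q ^+ k)%:E)%E) ->
  (\sum_(0 <= k <oo) u k <= (B / (1 - q))%:E)%E.
Proof.
move=> B0 /andP[q0 q1] uP.
apply: lime_le; first by apply: is_cvg_nneseries => k _ _; have /andP[] := uP k.
apply: nearW => n.
apply: (@le_trans _ _ (series (geometric B q) n)%:E).
  rewrite /series/= -sumEFin.
  by apply: lee_sum => k _; have /andP[] := uP k.
(* The ratio [q = 0] is computed directly: only the term [k = 0] survives, since [0 ^+ 0 = 1]. *)
move: q0; rewrite le_eqVlt => /predU1P[<-|q0].
  rewrite lee_fin /series/= subr0 invr1 mulr1.
  case: n => [|n]; first by rewrite big_geq.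
  rewrite big_nat_recl//= big1 ?addr0 ?expr0 ?mulr1// => i _.
  by rewrite exprS mul0r mulr0.
rewrite lee_fin; apply: geometric_le_lim => //.
by rewrite ger0_norm// ltW.
Qed.

(** Membership in weak [L^a]. The bound holds at every [t > 0], not only for large [t], so it can be
    rescaled with explicit constants. *)
Definition tail_bound (R : realType) (d : measure_display)
    (Omega : measurableType d) (P : probability Omega R) (V : Omega -> R)
    (a C : R) : Prop :=
  forall t : R, 0 < t -> (P [set w | (t < `|V w|)%R] <= (C * t `^ (- a))%:E)%E.

Section DyadicMoments.
Context {R : realType} {d : measure_display} {Omega : measurableType d}.
Variable P : probability Omega R.
Implicit Types U V : {RV P >-> R}.

Lemma measurable_gt_norm (f : Omega -> R) c :
  measurable_fun setT f -> measurable [set w | c < `|f w|].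
Proof.
move=> mf; rewrite (_ : mkset _ = (Num.norm \o f) @^-1` `]c, +oo[).
  by rewrite -[X in measurable X]setTI; apply: measurableT_comp.
by apply/seteqP; split => w /=; rewrite in_itv/= andbT.
Qed.

(** A layer-cake estimate: [f] is dominated by the sum over [k] of [b k] times the indicator of
    [s k < |x|]. Integrating term by term and inserting the tail bound leaves a geometric series.
    One level per point suffices, since all terms are nonnegative. *)
Lemma integral_le_tail_series V (f : R -> R) (b s : nat -> R) (a B C q : R) :
  measurable_fun setT f -> (forall x, 0 <= f x) ->
  (forall k, 0 <= b k) -> (forall k, 0 < s k) ->
  (forall x, f x = 0 \/ exists2 k, s k < `|x| & f x <= b k) ->
  tail_bound P V a C ->
  0 <= B -> 0 <= C -> 0 <= q < 1 ->
  (forall k, b k * s k `^ (- a) <= B * q ^+ k) ->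
  (\int[P]_w (f (V w))%:E <= (C * B / (1 - q))%:E)%E.
Proof.
move=> mf f0 b0 s0 fE tailV B0 C0 q01 bs.
pose A k := [set w | s k < `|V w|].
have mA k : measurable (A k) by apply: measurable_gt_norm.
pose g k w : \bar R := ((b k)%:E * (\1_(A k) w)%:E)%E.
have g0 k w : (0 <= g k w)%E by rewrite mule_ge0 ?lee_fin.
have mg k : measurable_fun [set: Omega] (g k).
  by apply/measurable_EFinP/measurable_funM => //; exact: measurable_indic.
apply: (@le_trans _ _ (\int[P]_w (\sum_(0 <= k <oo) g k w))%E).
  apply: ge0_le_integral => //.
  - by move=> w _; rewrite lee_fin.
  - by apply/measurable_EFinP/measurableT_comp.
  - exact: ge0_emeasurable_sum.
  move=> w _; have [->|[k sk fb]] := fE (V w); first exact: nneseries_ge0.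
  have gk : (g k w <= \sum_(0 <= i <oo) g i w)%E.
    apply: le_trans (nneseries_lim_ge k.+1 _) => //.
    by rewrite big_nat_recr//= leeDr// sume_ge0.
  by apply: le_trans gk; rewrite /g indicE mem_set//= mule1 lee_fin.
rewrite integral_nneseries//.
apply: nneseries_le_geometric => //; first by rewrite mulr_ge0.
move=> k; apply/andP; split; first exact: integral_ge0.
rewrite ge0_integralZl ?lee_fin//; last first.
  by apply/measurable_EFinP; exact: measurable_indic.
rewrite integral_indic// setIT.
apply: (@le_trans _ _ ((b k)%:E * (C * s k `^ (- a))%:E)%E).
  by apply: lee_wpmul2l; rewrite ?lee_fin//; exact: tailV.
by rewrite -EFinM lee_fin mulrCA -mulrA ler_wpM2l.
Qed.

End DyadicMoments.

(** * Laws, independence and second moments of sums *)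

Section SameLaw.
Context {R : realType} {d d0 dE : measure_display}.
Context {Omega : measurableType d} {Omega0 : measurableType d0}.
Context {E : measurableType dE}.
Variables (P : probability Omega R) (P0 : probability Omega0 R).
Variables (U : {RV P >-> E}) (V : {RV P0 >-> E}).
Hypothesis UV : has_law P U (pushforward P0 V).

Lemma ge0_integral_same_law (f : E -> \bar R) :
  measurable_fun setT f -> (forall x, (0 <= f x)%E) ->
  (\int[P]_w f (U w) = \int[P0]_w f (V w))%E.
Proof.
move=> mf f0; rewrite -!ge0_integral_distribution//.
by apply: eq_measure_integral => A mA _; exact: UV.
Qed.

Lemma integrable_same_law (f : E -> R) : measurable_fun setT f ->
  P0.-integrable setT (EFin \o (f \o V)) ->
  P.-integrable setT (EFin \o (f \o U)).
Proof.
move=> mf /integrableP[_ iV]; apply/integrableP; split.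
  by apply/measurable_EFinP/measurableT_comp.
apply: le_lt_trans iV.
rewrite (ge0_integral_same_law (f := fun x => `|(f x)%:E|%E))//.
by apply: measurableT_comp => //; exact/measurable_EFinP.
Qed.

Lemma Rintegral_same_law (f : E -> R) : measurable_fun setT f ->
  P0.-integrable setT (EFin \o (f \o V)) ->
  \int[P]_w f (U w) = \int[P0]_w f (V w).
Proof.
move=> mf iV; have iU := integrable_same_law mf iV.
have mEf : measurable_fun [set: E] (EFin \o f) by exact/measurable_EFinP.
congr fine.
rewrite -(integral_distribution (f := EFin \o f))//.
rewrite -(integral_distribution (f := EFin \o f))//.
by apply: eq_measure_integral => A mA _; exact: UV.
Qed.

End SameLaw.

Section BoundedMoments.
Context {R : realType} {d : measure_display} {Omega : measurableType d}.
Variable P : probability Omega R.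

Lemma bounded_integrable (f : Omega -> R) (c : R) :
  measurable_fun setT f -> (forall w, `|f w| <= c) ->
  P.-integrable setT (EFin \o f).
Proof.
move=> mf fc; apply: measurable_bounded_integrable => //.
  by apply: le_lt_trans (probability_le1 _ _) (ltry _).
exists c; split; first exact: num_real.
by move=> x cx w _ /=; apply: le_trans (fc w) (ltW cx).
Qed.

Definition pair_rv (U V : {RV P >-> R}) (w : Omega) : R * R := (U w, V w).

Let measurable_pair_rv U V : measurable_fun setT (pair_rv U V).
Proof. exact: measurable_fun_pair. Qed.

HB.instance Definition _ U V := @isMeasurableFun.Build _ _ _ _ _
  (measurable_pair_rv U V).

(** The joint law of [(U, V)] agrees with the product of the marginal laws on rectangles, hence
    everywhere, and Fubini factors the integral. Boundedness of [g] supplies the integrability. *)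
Lemma Rintegral_mul_indep (U V : {RV P >-> R}) (g : R -> R) (c : R) :
  independent2 P U V -> measurable_fun setT g -> (forall x, `|g x| <= c) ->
  \int[P]_w (g (U w) * g (V w)) = \int[P]_w g (U w) * \int[P]_w g (V w).
Proof.
move=> indUV mg gc.
have c0 : 0 <= c by apply: le_trans (gc 0).
pose f (z : R * R) : R := g z.1 * g z.2.
have mf : measurable_fun setT f.
  by apply: measurable_funM; apply: measurableT_comp => //.
have fc z : `|f z| <= c * c by rewrite normrM ler_pM.
have intg (W : {RV P >-> R}) : P.-integrable setT (EFin \o (g \o W)).
  apply: (@bounded_integrable _ c) => [|w]; last exact: gc.
  exact: measurableT_comp.
pose m1 : probability _ R := distribution P U.
pose m2 : probability _ R := distribution P V.
have lawE A : measurable A ->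
    (m1 \x m2)%E A = distribution P (pair_rv U V : {mfun Omega >-> _}) A.
  by apply: product_measure_unique => B C mB mC; exact: indUV.
have mEf : measurable_fun [set: R * R] (EFin \o f) by exact/measurable_EFinP.
have intf : P.-integrable setT (EFin \o (f \o pair_rv U V)).
  apply: (@bounded_integrable _ (c * c)) => [|w]; last exact: fc.
  exact: measurableT_comp.
have mEg : measurable_fun [set: R] (EFin \o g) by exact/measurable_EFinP.
have int12 : (m1 \x m2)%E.-integrable setT (EFin \o f).
  apply/integrable12ltyP => //.
  apply: (@le_lt_trans _ _ (\int[m1]_x \int[m2]_y (c * c)%:E)%E); last first.
    under eq_integral do rewrite integral_cst//= (probability_setT m2) mule1.
    by rewrite integral_cst//= (probability_setT m1) mule1 ltry.
  apply: ge0_le_integral => //.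
  - by move=> x _; apply: integral_ge0.
  - have mabs : measurable_fun setT (abse \o (EFin \o f)).
      exact: measurableT_comp.
    exact: (measurable_fun_fubini_tonelli_F _ mabs (fun=> abse_ge0 _)).
  - move=> x _.
    have mfx : measurable_fun [set: R] (fun y => f (x, y)).
      by rewrite /f /=; apply: measurable_funM => //; exact: measurable_cst.
    apply: ge0_le_integral => //.
      by apply: measurableT_comp => //; exact/measurable_EFinP.
    by move=> y _; rewrite lee_fin fc.
have E2 : (\int[m2]_y (g y)%:E)%E = (\int[P]_w g (V w))%:E.
  rewrite (integral_distribution mEg (intg V)) /Rintegral fineK//.
  exact: integrable_fin_num (intg V).
have E1 : (\int[m1]_y (g y)%:E)%E = (\int[P]_w g (U w))%:E.
  rewrite (integral_distribution mEg (intg U)) /Rintegral fineK//.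
  exact: integrable_fin_num (intg U).
have int1 : m1.-integrable setT (EFin \o g).
  apply: integrable_pushforward => //; exact: intg.
have int2 : m2.-integrable setT (EFin \o g).
  apply: integrable_pushforward => //; exact: intg.
rewrite /Rintegral.
transitivity (fine (\int[m1 \x m2]_z (f z)%:E)%E).
  congr fine; rewrite (eq_measure_integral
    (distribution P (pair_rv U V : {mfun Omega >-> _}))); last first.
    by move=> A mA _; exact: lawE.
  by rewrite (integral_distribution mEf).
rewrite -[X in fine X](integral12_prod_meas1 int12) /fubini_F.
have inner x : (\int[m2]_y (f (x, y))%:E)%E =
    ((\int[P]_w g (V w))%:E * (g x)%:E)%E.
  under eq_integral do rewrite /f EFinM/=.
  by rewrite integralZl// E2 muleC.
rewrite (eq_integral (fun x => ((\int[P]_w g (V w))%:E * (g x)%:E)%E)).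
  by rewrite integralZl// E1 /= mulrC.
by move=> x _; exact: inner.
Qed.

(** Variances add: by induction on [n], the cross term in the square of [S n + g (U n)] has mean
    zero. *)
Lemma Rintegral_sum_sqr_le (U : nat -> {RV P >-> R}) (g : R -> R) (c v : R) :
  (forall s t, s != t -> independent2 P (U s) (U t)) ->
  measurable_fun setT g -> (forall x, `|g x| <= c) ->
  (forall t, \int[P]_w g (U t w) = 0) ->
  (forall t, \int[P]_w (g (U t w) ^+ 2) <= v) ->
  forall n, \int[P]_w ((\sum_(t < n) g (U t w)) ^+ 2) <= v *+ n.
Proof.
move=> indU mg gc g0 gv.
have c0 : 0 <= c by apply: le_trans (gc 0).
pose S n w := \sum_(t < n) g (U t w).
have mS n : measurable_fun [set: Omega] (S n).
  by apply: measurable_sum => t; exact: measurableT_comp.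
have mgU n : measurable_fun [set: Omega] (g \o U n) by exact: measurableT_comp.
have Sc n w : `|S n w| <= c *+ n.
  apply: le_trans (ler_norm_sum _ _ _) _.
  by apply: le_trans (ler_sum _ (fun i _ => gc _)) _; rewrite sumr_const card_ord.
have iSg k n : P.-integrable setT (EFin \o (fun w => S k w * g (U n w))).
  apply: (@bounded_integrable _ (c *+ k * c)) => [|w].
    exact: (measurable_funM (mS k) (mgU n)).
  by rewrite normrM ler_pM.
have igg k n :
    P.-integrable setT (EFin \o (fun w => g (U k w) * g (U n w))).
  apply: (@bounded_integrable _ (c * c)) => [|w].
    exact: (measurable_funM (mgU k) (mgU n)).
  by rewrite normrM ler_pM.
(* Pairwise independence does not make [S k] independent of [U n], so [S k] is expanded by a second
   induction into products of two single terms. *)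
have cross n k : (k <= n)%N -> \int[P]_w (S k w * g (U n w)) = 0.
  elim: k => [_|k IH kn].
    rewrite /S; under eq_Rintegral do rewrite big_ord0 mul0r.
    by rewrite Rintegral_cst// mul0r.
  rewrite /S; under eq_Rintegral do rewrite big_ord_recr/= mulrDl.
  rewrite (RintegralD _ (iSg k n) (igg k n))// IH ?(ltnW kn)// add0r.
  by rewrite (Rintegral_mul_indep (indU _ _ _) mg gc) ?g0 ?mul0r// ltn_eqF.
have iS2 n : P.-integrable setT (EFin \o (fun w => S n w ^+ 2)).
  apply: (@bounded_integrable _ ((c *+ n) ^+ 2)) => [|w].
    exact: measurable_funX.
  by rewrite normrX lerXn2r ?nnegrE ?mulrn_wge0.
elim=> [|n IH].
  under eq_Rintegral do rewrite big_ord0 expr0n.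
  by rewrite Rintegral_cst// mul0r mulr0n.
rewrite (_ : Rintegral _ _ _ =
    \int[P]_w (S n w ^+ 2 + (2 * (S n w * g (U n w)) + g (U n w) * g (U n w)))).
  have i2 : P.-integrable setT (EFin \o (fun w => 2 * (S n w * g (U n w)))).
    have := integrableZl measurableT 2 (iSg n n).
    by apply: eq_integrable => //.
  rewrite RintegralD//; last first.
    have := integrableD measurableT i2 (igg n n).
    by apply: eq_integrable => //.
  rewrite (RintegralD _ i2 (igg n n))//.
  rewrite RintegralZl// cross// mulr0 add0r mulrSr lerD//.
  exact: gv.
apply: eq_Rintegral => w _; rewrite big_ord_recr/=.
by rewrite -/(S n w); ring.
Qed.

End BoundedMoments.

(** * Truncation *)

Section Truncation.
Context {R : realType}.
Implicit Types (c x : R).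

(** Values beyond [c] are sent to [0], not clamped to the endpoints, so [x - trunc c x] is either
    [0] or [x]. *)
Definition trunc c x : R := x * \1_`[- c, c] x.

Lemma trunc_id c x : `|x| <= c -> trunc c x = x.
Proof.
by move=> xc; rewrite /trunc indicE mem_set ?mulr1//= in_itv/= -ler_norml.
Qed.

Lemma trunc_0 c x : c < `|x| -> trunc c x = 0.
Proof.
move=> cx; rewrite /trunc indicE memNset ?mulr0//= in_itv/= -ler_norml.
by apply/negP; rewrite -ltNge.
Qed.

Lemma trunc_le c x : 0 <= c -> `|trunc c x| <= c.
Proof.
move=> c0; have [xc|cx] := leP `|x| c; first by rewrite trunc_id.
by rewrite trunc_0// normr0.
Qed.

Lemma measurable_trunc c : measurable_fun setT (trunc c).
Proof. by apply: measurable_funM => //; exact: measurable_indic. Qed.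

Lemma exprn_powR x n r : 0 <= x -> (x ^+ n) `^ r = (x `^ r) ^+ n.
Proof.
by move=> x0; rewrite -powR_mulrn// powRAC powR_mulrn ?powR_ge0.
Qed.

Lemma gt1_ltr_powR (b r s : R) : 1 < b -> r < s -> b `^ r < b `^ s.
Proof.
move=> b1 rs; rewrite /powR gt_eqF ?(lt_trans _ b1)// ltr_expR.
by rewrite ltr_pM2r// ln_gt0.
Qed.

End Truncation.

Section TruncatedMoments.
Context {R : realType} {d : measure_display} {Omega : measurableType d}.
Variables (P : probability Omega R) (V : {RV P >-> R}) (a C c : R).
Hypotheses (a1 : 1 < a) (a2 : a < 2) (C0 : 0 <= C) (c0 : 0 < c).
Hypothesis tailV : tail_bound P V a C.

(** The ratio [2^(1 - a)] of the dyadic series for the truncation bias, below [1] because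
    [1 < a]. *)
Lemma two_powRN_lt1 : 0 <= 2 * 2 `^ (- a) < 1.
Proof.
rewrite mulr_ge0 ?powR_ge0//= -ltr_pdivlMl// mulr1 -powR_inv1//.
by rewrite gt1_ltr_powR ?ltrN2// ltr1n.
Qed.

(** The ratio [2^(a - 2)] of the dyadic series for the truncated second moment, below [1] because
    [a < 2]. *)
Lemma half_powRN_lt1 : 0 <= (2^-1 : R) ^+ 2 * 2^-1 `^ (- a) < 1.
Proof.
rewrite mulr_ge0 ?powR_ge0 ?exprn_ge0//=.
rewrite -powR_inv1// -powRrM mulN1r opprK powR_inv1// exprVn.
rewrite mulrC ltr_pdivrMr ?exprn_gt0// mul1r -powR_mulrn//.
by rewrite gt1_ltr_powR// ltr1n.
Qed.

(** The levels go up: where [c 2^k < |x| <= c 2^(k+1)], the residual is at most [c 2^(k+1)]. *)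
Lemma integral_trunc_residual_le :
  (\int[P]_w (`|V w - trunc c (V w)|)%:E <=
   (C * (2 * (c * c `^ (- a))) / (1 - 2 * 2 `^ (- a)))%:E)%E.
Proof.
pose f x := `|x - trunc c x|.
apply: (integral_le_tail_series (f := f) (b := fun k => c * 2 ^+ k.+1)
  (s := fun k => c * 2 ^+ k) _ _ _ _ _ tailV) => //.
- apply: measurableT_comp => //; apply: measurable_funB => //.
  exact: measurable_trunc.
- by move=> x; exact: normr_ge0.
- by move=> k; rewrite mulr_ge0 ?exprn_ge0 ?ltW.
- by move=> k; rewrite mulr_gt0 ?exprn_gt0.
- move=> x; have [xc|cx] := leP `|x| c.
    by left; rewrite /f trunc_id// subrr normr0.
  right; rewrite /f trunc_0// subr0.
  have : exists k, `|x| <= c * 2 ^+ k.+1.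
    have [k kx] : exists k, `|x| / c < k%:R.
      by exists (Num.trunc (`|x| / c)).+1; exact: truncnS_gt.
    exists k; rewrite mulrC -ler_pdivrMr//.
    rewrite (le_trans (ltW kx))// -natrX ler_nat.
    by rewrite (leq_trans _ (ltnW (ltn_expl k.+1 _))).
  (* Minimality of [k] gives the lower bound on [|x|]; for [k = 0] that bound is [c < |x|]. *)
  move=> /ex_minnP[k xk kmin]; exists k => //.
  case: k xk kmin => [|k] xk kmin; first by rewrite expr0 mulr1.
  rewrite ltNge; apply/negP => /kmin; by rewrite ltnn.
- by rewrite !mulr_ge0 ?powR_ge0// ltW.
- exact: two_powRN_lt1.
- move=> k; have cge0 := ltW c0; rewrite powRM ?exprn_ge0// exprn_powR// exprMn exprS.
  by rewrite le_eqVlt; apply/orP; left; apply/eqP; ring.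
Qed.

(** The levels go down: where [c 2^-(k+1) < |x| <= c 2^-k], the square is at most [(c 2^-k)^2]. The
    point [0] lies in no shell, but [f] vanishes there. *)
Lemma integral_trunc_sqr_le :
  (\int[P]_w ((trunc c (V w)) ^+ 2)%:E <=
   (C * (c ^+ 2 * c `^ (- a) * 2^-1 `^ (- a)) /
     (1 - 2^-1 ^+ 2 * 2^-1 `^ (- a)))%:E)%E.
Proof.
pose f x := trunc c x ^+ 2.
apply: (integral_le_tail_series (f := f) (b := fun k => (c * 2^-1 ^+ k) ^+ 2)
  (s := fun k => c * 2^-1 ^+ k.+1) _ _ _ _ _ tailV) => //.
- by apply: measurable_funX; exact: measurable_trunc.
- by move=> x; exact: sqr_ge0.
- by move=> k; exact: sqr_ge0.
- by move=> k; rewrite mulr_gt0 ?exprn_gt0.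
- move=> x; have [xc|cx] := leP `|x| c; last first.
    by left; rewrite /f trunc_0// expr0n.
  have [->|x0] := eqVneq x 0; first by left; rewrite /f /trunc mul0r expr0n.
  right; rewrite /f trunc_id//.
  have : exists k, c * 2^-1 ^+ k.+1 < `|x|.
    have [k kx] : exists k, c / `|x| < k%:R.
      by exists (Num.trunc (c / `|x|)).+1; exact: truncnS_gt.
    exists k; rewrite exprVn ltr_pdivrMr ?exprn_gt0// mulrC.
    rewrite -ltr_pdivrMr ?normr_gt0// (lt_le_trans kx)// -natrX ler_nat.
    by rewrite (leq_trans _ (ltnW (ltn_expl k.+1 _))).
  move=> /ex_minnP[k xk kmin]; exists k => //.
  suff xle : `|x| <= c * 2^-1 ^+ k.
    rewrite -(real_normK (num_real x)) lerXn2r// ?nnegrE.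
    exact: le_trans xle.
  case: k xk kmin => [|k] xk kmin; first by rewrite expr0 mulr1.
  rewrite leNgt; apply/negP => /kmin; by rewrite ltnn.
- by rewrite !mulr_ge0 ?powR_ge0// ltW.
- exact: half_powRN_lt1.
- move=> k; have cge0 := ltW c0; rewrite powRM ?exprn_ge0// exprn_powR//.
  rewrite le_eqVlt; apply/orP; left; apply/eqP.
  rewrite [X in X * _]exprMn -[(_ ^+ k) ^+ 2]exprM mulnC exprM.
  by rewrite [_ ^+ k.+1]exprS [RHS]mulrC !exprMn; ring.
Qed.

(** The truncated part is bounded and the residual has a finite integral. *)
Lemma integrable_tail_bound : P.-integrable setT (EFin \o V).
Proof.
have mt : measurable_fun [set: Omega] (trunc c \o V).
  by apply: measurableT_comp => //; exact: measurable_trunc.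
have i1 : P.-integrable setT (EFin \o (trunc c \o V)).
  apply: (@bounded_integrable _ _ _ _ _ c) => // w.
  exact: trunc_le (ltW c0).
have i2 : P.-integrable setT (EFin \o (fun w => V w - trunc c (V w))).
  apply/integrableP; split.
    by apply/measurable_EFinP; exact: measurable_funB.
  exact: le_lt_trans integral_trunc_residual_le (ltry _).
have := integrableD measurableT i1 i2.
by apply: eq_integrable => // w _; rewrite /= -EFinD subrKC.
Qed.

Lemma Rintegral_trunc_bias_le :
  `|\int[P]_w trunc c (V w) - \int[P]_w V w| <=
  C * (2 * (c * c `^ (- a))) / (1 - 2 * 2 `^ (- a)).
Proof.
have iV := integrable_tail_bound.
have mt : measurable_fun [set: Omega] (trunc c \o V).
  by apply: measurableT_comp => //; exact: measurable_trunc.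
have i1 : P.-integrable setT (EFin \o (trunc c \o V)).
  apply: (@bounded_integrable _ _ _ _ _ c) => // w.
  exact: trunc_le (ltW c0).
have i2 : P.-integrable setT (EFin \o (fun w => V w - trunc c (V w))).
  have := integrableB measurableT iV i1.
  by apply: eq_integrable => // w _; rewrite /= -EFinB.
rewrite distrC -RintegralB//.
apply: le_trans (le_normr_Rintegral _ i2) _ => //.
rewrite -lee_fin /Rintegral fineK; first exact: integral_trunc_residual_le.
exact: integrable_fin_num (integrable_norm i2).
Qed.

End TruncatedMoments.

(** * The weak law of large numbers under a tail bound *)

Section WeakLaw.
Context {R : realType} {d : measure_display} {Omega : measurableType d}.
Variable P : probability Omega R.

Lemma chebyshev_sqr (S : Omega -> R) (e v : R) : 0 < e ->
  measurable_fun setT S -> P.-integrable setT (EFin \o (fun w => S w ^+ 2)) ->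
  \int[P]_w (S w ^+ 2) <= v ->
  (P [set w | (e < `|S w|)%R] <= (v / e ^+ 2)%:E)%E.
Proof.
move=> e0 mS iS Sv.
have mA : measurable [set w | e < `|S w|] by exact: measurable_gt_norm.
rewrite EFinM lee_pdivlMr ?exprn_gt0//.
apply: (@le_trans _ _ (\int[P]_w (S w ^+ 2)%:E)%E); last first.
  rewrite -[leLHS]fineK ?lee_fin//; exact: integrable_fin_num iS.
rewrite muleC -[X in P X]setIT -integral_indic// -ge0_integralZl//; last 2 first.
  - by apply/measurable_EFinP; exact: measurable_indic.
  - by rewrite lee_fin exprn_ge0// ltW.
apply: ge0_le_integral => //.
- by move=> w _; rewrite -EFinM lee_fin mulr_ge0 ?exprn_ge0 ?(ltW e0).
- by apply/measurable_EFinP/measurable_funM => //; exact: measurable_indic.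
- by apply/measurable_EFinP; exact: measurable_funX.
- move=> w _; rewrite -EFinM lee_fin indicE.
  have [|_] := boolP (w \in _); last by rewrite mulr0 sqr_ge0.
  rewrite inE/= mulr1 => /ltW eS; rewrite -[leRHS]real_normK ?num_real//.
  by rewrite lerXn2r ?nnegrE ?(ltW e0).
Qed.

Variables (U : nat -> {RV P >-> R}) (a C : R).
Hypotheses (a1 : 1 < a) (a2 : a < 2) (C0 : 0 <= C).
Hypothesis indU : forall s t, s != t -> independent2 P (U s) (U t).
Hypothesis idU : forall t, has_law P (U t) (pushforward P (U 0%N)).
Hypothesis tailU : tail_bound P (U 0%N) a C.

Lemma tail_bound_same_law t : tail_bound P (U t) a C.
Proof.
move=> s s0; have := tailU s0; congr (_ <= _)%E; apply/esym.
have -> : [set w | s < `|U t w|] = U t @^-1` [set x | s < `|x|] by [].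
rewrite idU//; apply: (measurable_gt_norm (f := fun x : R => x)).
exact: measurable_id.
Qed.

(** Truncate at [c = K n^(1/a)]. Some [|U t|] with [t < n] exceeds [c] with probability at most
    [n C c^(-a) = C K^(-a)]. Off that event the error is the centred truncated mean plus the bias;
    the bias is at most [D1 n^(1/a - 1)], and Chebyshev at level [L n^(1/a)] controls the centred
    sum. [K] and [L] make each of the two probabilities at most [eps / 2]. *)
Lemma stoch_bigO_mean :
  stoch_bigO P
    (fun n w => n%:R^-1 * (\sum_(t < n) U t w) - \int[P]_w U 0%N w)
    (fun n => n%:R `^ (- (1 - a^-1))).
Proof.
move=> eps eps0.
have a0 : 0 < a by apply: lt_trans a1.
pose q1 : R := 1 - 2 * 2 `^ (- a).
pose q2 : R := 1 - 2^-1 ^+ 2 * 2^-1 `^ (- a).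
have q1_gt0 : 0 < q1 by rewrite subr_gt0; have /andP[] := two_powRN_lt1 a1.
have q2_gt0 : 0 < q2 by rewrite subr_gt0; have /andP[] := half_powRN_lt1 a2.
(* Chosen so that [C K^(-a) <= eps / 2]; the [+ 1] keeps the base positive when [C = 0]. *)
pose K := (2 * C / eps + 1) `^ (a^-1).
have Kbase : 0 < 2 * C / eps + 1.
  by rewrite ltr_wpDl// !mulr_ge0// invr_ge0 ltW.
have K0 : 0 < K by rewrite powR_gt0.
have KNa : K `^ (- a) = (2 * C / eps + 1)^-1.
  rewrite powRN /K -powRrM mulVf ?gt_eqF// powRr1//; exact: ltW.
have CK : C * K `^ (- a) <= eps / 2.
  rewrite KNa ler_pdivrMr// -subr_ge0.
  rewrite (_ : _ - _ = eps / 2); first by rewrite divr_ge0// ltW.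
  by field; rewrite gt_eqF.
pose k := K `^ (- a).
have k0 : 0 <= k by rewrite powR_ge0.
pose D1 := C * (2 * (K * k)) / q1.
pose D2 := C * (K ^+ 2 * k * 2^-1 `^ (- a)) / q2.
have D20 : 0 <= D2.
  by rewrite divr_ge0 ?(ltW q2_gt0)// !mulr_ge0 ?powR_ge0 ?sqr_ge0.
(* Since [1 <= L], [D2 / L^2 <= D2 / L], and the latter is at most [eps / 2]. *)
pose L := 1 + 2 * D2 / eps.
have L1 : 1 <= L by rewrite lerDl divr_ge0 ?(ltW eps0)// mulr_ge0.
have L0 : 0 < L by apply: lt_le_trans L1.
have D2L : D2 / L ^+ 2 <= eps / 2.
  apply: (@le_trans _ _ (D2 / L)).
    rewrite ler_wpM2l// lef_pV2 ?posrE ?exprn_gt0//.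
    by rewrite expr2 ler_peMl// ltW.
  rewrite ler_pdivrMr// /L -subr_ge0.
  rewrite (_ : _ - _ = eps / 2); first by rewrite divr_ge0// ltW.
  by field; rewrite gt_eqF.
exists (D1 + L), 1%N => n n1.
have n0 : 0 < n%:R :> R by rewrite ltr0n.
have nn0 : n%:R != 0 :> R by rewrite gt_eqF.
(* With [N = n^(1/a)] the claimed rate is [N / n], and [N^(-a) = 1 / n]. *)
pose N : R := n%:R `^ a^-1.
have N0 : 0 < N by rewrite powR_gt0.
have NNa : N `^ (- a) = n%:R^-1.
  by rewrite powRN /N -powRrM mulVf ?gt_eqF// powRr1// ltW.
have rE : n%:R `^ (- (1 - a^-1)) = N / n%:R :> R.
  rewrite opprB powRB; last by rewrite nn0 implybT.
  by rewrite powRr1// ltW.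
rewrite rE.
pose c := K * N.
have c0 : 0 < c by rewrite mulr_gt0.
have cNa : c `^ (- a) = k / n%:R by rewrite powRM ?NNa// ltW.
pose m := \int[P]_w trunc c (U 0%N w).
pose g x := trunc c x - m.
have mtr : measurable_fun setT (trunc c) by exact: measurable_trunc.
have mg : measurable_fun setT g by exact: measurable_funB.
have trc x : `|trunc c x| <= c by exact: trunc_le (ltW c0).
have gc x : `|g x| <= c + `|m|.
  by apply: le_trans (ler_normB _ _) _; rewrite lerD2r.
have itr t : P.-integrable setT (EFin \o (trunc c \o U t)).
  apply: (@bounded_integrable _ _ _ _ _ c) => [|w]; last exact: trc.
  exact: measurableT_comp.
have icst (r : R) : P.-integrable setT (EFin \o (fun=> r)).
  exact: (@bounded_integrable _ _ _ _ _ `|r|).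
have m_same t : \int[P]_w trunc c (U t w) = m.
  exact: (Rintegral_same_law (idU t) mtr (itr 0%N)).
have Rcst (r : R) : \int[P]_w r = r.
  by rewrite Rintegral_cst//= (probability_setT P) mulr1.
have g_mean t : \int[P]_w g (U t w) = 0.
  by rewrite /g (RintegralB _ (itr t) (icst m))//= m_same Rcst subrr.
have itr2 t : P.-integrable setT (EFin \o (fun w => trunc c (U t w) ^+ 2)).
  apply: (@bounded_integrable _ _ _ _ _ (c ^+ 2)) => [|w].
    by apply: measurable_funX; exact: measurableT_comp.
  by rewrite normrX lerXn2r ?nnegrE// ltW.
have g_var t : \int[P]_w (g (U t w) ^+ 2) <= D2 * (N ^+ 2 / n%:R).
  (* The variance is at most the raw second moment: the terms in [m] contribute [- m^2]. *)
  apply: (@le_trans _ _ (\int[P]_w (trunc c (U t w) ^+ 2))).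
    have -> : \int[P]_w (g (U t w) ^+ 2) = \int[P]_w
        (trunc c (U t w) ^+ 2 + (- (2 * m) * trunc c (U t w) + m ^+ 2)).
      by apply: eq_Rintegral => w _; rewrite /g; ring.
    have iZ : P.-integrable setT (EFin \o (fun w => - (2 * m) * trunc c (U t w))).
      by have := integrableZl measurableT (- (2 * m)) (itr t); exact: eq_integrable.
    have iD : P.-integrable setT
        (EFin \o (fun w => - (2 * m) * trunc c (U t w) + m ^+ 2)).
      have := integrableD measurableT iZ (icst (m ^+ 2)).
      by apply: eq_integrable.
    rewrite RintegralD// RintegralD// RintegralZl//; last exact: itr.
    rewrite m_same Rcst gerDl -subr_ge0.
    by rewrite (_ : _ - _ = m ^+ 2) ?sqr_ge0//; ring.
  rewrite -lee_fin [X in (X <= _)%E]fineK; last first.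
    exact: integrable_fin_num (itr2 t).
  apply: le_trans (integral_trunc_sqr_le a2 C0 c0 (@tail_bound_same_law t)) _.
  rewrite cNa lee_fin le_eqVlt /D2 -/q2; apply/orP; left; apply/eqP.
  by rewrite /c; field; rewrite nn0 gt_eqF.
have bias : `|m - \int[P]_w U 0%N w| <= D1 * (N / n%:R).
  apply: le_trans (Rintegral_trunc_bias_le a1 C0 c0 tailU) _.
  rewrite cNa le_eqVlt /D1 -/q1; apply/orP; left; apply/eqP.
  by rewrite /c; field; rewrite nn0 gt_eqF.
pose S w := \sum_(t < n) g (U t w).
have mS : measurable_fun [set: Omega] S.
  by apply: measurable_sum => t; exact: measurableT_comp.
have S_var : \int[P]_w (S w ^+ 2) <= D2 * N ^+ 2.
  have := Rintegral_sum_sqr_le indU mg gc g_mean g_var n.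
  rewrite -[leRHS]mulr_natr (_ : _ * n%:R = D2 * N ^+ 2)//.
  by field.
have iS2 : P.-integrable setT (EFin \o (fun w => S w ^+ 2)).
  apply: (@bounded_integrable _ _ _ _ _ (((c + `|m|) *+ n) ^+ 2)) => [|w].
    exact: measurable_funX.
  have cm0 : 0 <= c + `|m| by rewrite addr_ge0// ltW.
  rewrite normrX lerXn2r ?nnegrE ?mulrn_wge0//.
  apply: le_trans (ler_norm_sum _ _ _) _.
  by apply: le_trans (ler_sum _ (fun i _ => gc _)) _; rewrite sumr_const card_ord.
have LN0 : 0 < L * N by rewrite mulr_gt0.
have S_tail := chebyshev_sqr LN0 mS iS2 S_var.
(* For [t < n] these are the exceedance events, and [F n] is the deviation of the centred sum, so
   one union bound over [n + 1] events covers [A]. *)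
pose F t := if (t < n)%N then [set w | c < `|U t w|] else [set w | L * N < `|S w|].
have mF t : measurable (F t).
  by rewrite /F; case: ifP => _; exact: measurable_gt_norm.
set A := (X in P X).
have mA : measurable A.
  apply: measurable_gt_norm; apply: measurable_funB => //.
  by apply: measurable_funM => //; apply: measurable_sum.
have AF : A `<=` \big[setU/set0]_(t < n.+1) F t.
  move=> w Aw; rewrite big_ord_recr/=; apply: contrapT => /not_orP[noF noS].
  have Uc (t : 'I_n) : `|U t w| <= c.
    rewrite leNgt; apply/negP => cU; apply: noF.
    rewrite -bigcup_mkord; exists (t : nat) => //=.
    by rewrite /F ltn_ord.
  have {}noS : `|S w| <= L * N.
    by rewrite leNgt; apply/negP => h; apply: noS; rewrite /F ltnn.
  have ES : S w = \sum_(t < n) U t w - m *+ n.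
    rewrite /S /g big_split/= sumrN sumr_const card_ord; congr (_ - _).
    by apply: eq_bigr => t _; rewrite trunc_id.
  move: Aw; rewrite /A /= ltNge => /negP; apply.
  rewrite (_ : _ - _ = n%:R^-1 * S w + (m - \int[P]_w U 0%N w)); last first.
    by rewrite ES -mulr_natr; field.
  apply: le_trans (ler_normD _ _) _.
  rewrite mulrDl addrC lerD// normrM ger0_norm ?invr_ge0 ?(ltW n0)//.
  by rewrite mulrA mulrC ler_wpM2r// invr_ge0 ltW.
apply: (@le_trans _ _ (\sum_(t < n.+1) P (F t))%E).
  by apply: content_subadditive AF => // t _; exact: mF.
rewrite big_ord_recr/= [X in (_ + P X)%E](_ : _ = [set w | L * N < `|S w|]); last first.
  by rewrite /F ltnn.
rewrite [eps]splitr EFinD; apply: leeD; last first.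
  apply: le_trans S_tail _; rewrite lee_fin (le_trans _ D2L)//.
  rewrite le_eqVlt; apply/orP; left; apply/eqP.
  by field; rewrite !gt_eqF.
apply: (@le_trans _ _ (\sum_(t < n) (C * k / n%:R)%:E)%E).
  apply: lee_sum => t _; rewrite /F ltn_ord.
  by apply: le_trans (tail_bound_same_law _ c0) _; rewrite cNa mulrA.
by rewrite sumEFin sumr_const card_ord lee_fin -(mulr_natr (C * k / _)) divfK.
Qed.

End WeakLaw.

(** * Tails of the skew-t model *)

Section LawBounds.
Context {R : realType}.
Local Notation mu := (@lebesgue_measure R).

Lemma measurable_inv_sqrt : measurable_fun setT (fun x : R => (Num.sqrt x)^-1).
Proof.
under eq_fun do rewrite -powR_inv1 ?sqrtr_ge0//.
apply: (measurableT_comp (measurable_powR (-1))).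
by apply: continuous_measurable_fun; exact: sqrt_continuous.
Qed.

Lemma Gamma_ge0 (s : R) : 0 <= Gamma s.
Proof. by apply: Rintegral_ge0 => x _; rewrite mulr_ge0 ?powR_ge0 ?expR_ge0. Qed.

Lemma chi2_pdf_ge0 (nu x : R) : 0 <= chi2_pdf nu x.
Proof.
rewrite /chi2_pdf; case: ifP => // _.
by rewrite divr_ge0 ?mulr_ge0 ?powR_ge0 ?expR_ge0 ?Gamma_ge0.
Qed.

Lemma measurable_chi2_pdf (nu : R) : measurable_fun setT (chi2_pdf nu).
Proof.
apply: measurable_fun_ifT => //; first exact: measurable_fun_ltr.
apply: measurable_funM => //; apply: measurable_funM.
  exact: measurable_powR.
apply: measurableT_comp => //; apply: measurable_funM => //.
Qed.

(** Since [2 < nu], the power in the density is at most [u^(nu/2 - 1)] on []0, u[], and the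
    exponential is at most [1]; the interval has length [u]. *)
Lemma chi2_prob_lt_le (nu u : R) : 2 < nu -> 0 < u ->
  (chi2_prob nu `]-oo, u[ <=
   ((2 `^ (nu / 2) * Gamma (nu / 2))^-1 * u `^ (nu / 2))%:E)%E.
Proof.
move=> nu2 u0; set D := (_ * _)^-1.
have D0 : 0 <= D by rewrite invr_ge0 mulr_ge0 ?powR_ge0 ?Gamma_ge0.
have nu1 : 0 < nu / 2 - 1 by lra.
pose c := D * u `^ (nu / 2 - 1).
have c0 : 0 <= c by rewrite mulr_ge0 ?powR_ge0.
apply: (@le_trans _ _ (\int[mu]_(x in `]-oo, u[) (c * \1_`]0, u[ x)%:E)%E).
  apply: ge0_le_integral => //.
  - by move=> x _; rewrite lee_fin chi2_pdf_ge0.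
  - by apply/measurable_EFinP/measurable_funTS; exact: measurable_chi2_pdf.
  - by apply/measurable_EFinP/measurable_funTS/measurable_funM.
  move=> x; rewrite /= in_itv/= lee_fin => xu; rewrite /chi2_pdf.
  case: ifPn => [x0|_]; last by rewrite mulr_ge0.
  rewrite indicE mem_set ?mulr1/=; last by rewrite in_itv/= x0.
  rewrite -/D mulrC ler_wpM2l//.
  apply: (@le_trans _ _ (x `^ (nu / 2 - 1))).
    by rewrite ler_piMr ?powR_ge0// -[leRHS]expR0 ler_expR; lra.
  by rewrite ge0_ler_powR ?nnegrE ?(ltW nu1) ?(ltW x0) ?(ltW xu) ?(ltW u0).
under eq_integral do rewrite EFinM.
rewrite ge0_integralZl//; last first.
  by apply/measurable_EFinP/measurable_funTS; exact: measurable_indic.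
rewrite integral_indic//= setIidl; last first.
  by move=> x /=; rewrite !in_itv/= => /andP[].
rewrite lebesgue_measure_itv/= lte_fin u0 sube0 -EFinM lee_fin.
by rewrite /c -mulrA [_ * u]mulrC mulr_powRB1 ?(ltW u0)//; lra.
Qed.

Definition annulus (k : nat) : set R := [set x | k%:R <= `|x| < k.+1%:R].

Lemma measurable_annulus k : measurable (annulus k).
Proof.
rewrite (_ : annulus k = Num.norm @^-1` `[k%:R, k.+1%:R[).
  by rewrite -[X in measurable X]setTI; exact: normr_measurable.
by apply/seteqP; split => x /=; rewrite in_itv.
Qed.

(** The shell lies in two intervals of length [1], whence the factor [2], and the density there is
    at most its value at [k]. *)
Lemma normal_prob_annulus_le (k : nat) :
  (normal_prob 0 1 (annulus k) <=
   (2 * normal_peak 1 * expR (- (k%:R ^+ 2) / 2))%:E)%E.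
Proof.
set A := annulus k; pose c : R := normal_peak 1 * expR (- (k%:R ^+ 2) / 2).
have c0 : 0 <= c by rewrite mulr_ge0 ?normal_peak_ge0 ?expR_ge0.
have mA : measurable A := measurable_annulus k.
have muA : (mu A <= 2%:E)%E.
  apply: (@le_trans _ _ (mu (`[k%:R, k.+1%:R] `|` `[- k.+1%:R, - k%:R]))).
    apply: le_measure; rewrite ?inE//; first exact: measurableU.
    move=> x; rewrite /A /annulus/= !in_itv/=; have [x0|x0] := leP 0 x.
      by rewrite ger0_norm// => /andP[-> /ltW ->]; left.
    rewrite ltr0_norm// => /andP[kx xk]; right.
    by rewrite lerNl (ltW xk) lerNr kx.
  apply: le_trans (measureU2 _ _ _) _ => //.
  rewrite /= !lebesgue_measure_itv/= !lte_fin ltrN2 ltr_nat ltnSn.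
  rewrite -!EFinB -EFinD lee_fin -natr1; lra.
apply: (@le_trans _ _ (\int[mu]_(x in A) c%:E)%E).
  apply: ge0_le_integral => //.
  - by move=> x _; rewrite lee_fin normal_pdf_ge0.
  - by apply/measurable_EFinP/measurable_funTS; exact: measurable_normal_pdf.
  move=> x /andP[kx _]; rewrite lee_fin normal_pdfE ?oner_eq0//.
  rewrite ler_wpM2l ?normal_peak_ge0// /normal_fun ler_expR subr0 expr1n.
  rewrite !mulNr lerN2 ler_pM2r ?invr_gt0//.
  by rewrite -[leRHS]real_normK ?num_real// lerXn2r ?nnegrE.
rewrite integral_cst//= muleC -mulrA -/c [leRHS]EFinM.
by apply: lee_wpmul2r; rewrite ?lee_fin.
Qed.

(** From [y <= e^y] at [y = (k+1)/8] comes [(k+1)^4 <= 8^4 e^((k+1)/2)], and [(k-1)^2 >= 0] gives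
    [e^(-k^2/2) <= e^(1/2 - k)]. The exponents add up to [1 - k/2]. *)
Lemma gauss_powR_geometric (kappa : R) (k : nat) : 0 <= kappa -> kappa < 4 ->
  expR (- (k%:R ^+ 2) / 2) * k.+1%:R `^ kappa <=
  8 ^+ 4 * expR 1 * expR (- 2^-1) ^+ k.
Proof.
move=> kappa0 kappa4.
have k1 : k.+1%:R `^ kappa <= 8 ^+ 4 * expR (k.+1%:R / 2).
  apply: (@le_trans _ _ (k.+1%:R ^+ 4)).
    by rewrite -powR_mulrn// ler_powR ?ler1n// ltW.
  apply: (@le_trans _ _ ((8 * expR (k.+1%:R / 8)) ^+ 4)).
    rewrite lerXn2r ?nnegrE ?mulr_ge0 ?expR_ge0//.
    rewrite mulrC -ler_pdivrMr//; apply: le_trans (expR_ge1Dx _).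
    by rewrite lerDr.
  rewrite exprMn -expRM_natl (_ : 4 * _ = k.+1%:R / 2)//.
  by field.
have e1 : expR (- (k%:R ^+ 2) / 2) <= expR (2^-1 - k%:R) :> R.
  rewrite ler_expR -subr_ge0 (_ : _ - _ = (k%:R - 1) ^+ 2 / 2); last by field.
  by rewrite divr_ge0 ?sqr_ge0.
apply: (le_trans (ler_pM (expR_ge0 _) (powR_ge0 _ _) e1 k1)).
rewrite mulrCA -mulrA ler_pM2l ?exprn_gt0// -expRM_natl -!expRD ler_expR.
by rewrite -(natr1 k); lra.
Qed.

End LawBounds.

Section SkewTTail.
Context {R : realType} {d : measure_display} {Omega : measurableType d}.
Variables (P : probability Omega R) (p : nat) (kappa alpha : R).
Variables (Rho : 'M[R]_p) (W : {RV P >-> R}) (Z : {RV P >-> p.-tuple R}).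
Hypotheses (kappa2 : 2 < kappa) (kappa4 : kappa < 4).
Hypotheses (corrRho : correlation_mx Rho) (dataWZ : skew_t_data kappa Rho W Z).

Lemma measurable_skew_t_coord i :
  measurable_fun [set: Omega] (fun w => tnth (skew_t_vector alpha W Z w) i).
Proof.
rewrite /skew_t_vector; under eq_fun do rewrite tnth_mktuple.
have mZ : measurable_fun [set: Omega] (fun w => tnth (Z w) i).
  by apply: (measurableT_comp (measurable_tnth i)).
have mT : measurable_fun [set: Omega] (fun w => tnth (Z w) i / Num.sqrt (W w)).
  apply: measurable_funM => //.
  exact: (measurableT_comp measurable_inv_sqrt).
by apply: measurable_funD; apply: measurable_funM => //; exact: measurableT_comp.
Qed.

Lemma measurable_skew_t_vector :
  measurable_fun [set: Omega] (skew_t_vector alpha W Z).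
Proof.
by apply/measurable_fun_tnthP => i; exact: measurable_skew_t_coord.
Qed.

(** [gaussian_vector] is tested on a basis vector; the diagonal entry [1] selects the nondegenerate
    branch of [centered_normal]. *)
Lemma gaussian_coord_law i :
  has_law P (fun w => tnth (Z w) i) (normal_prob (0 : R) 1).
Proof.
case: dataWZ => _ gZ _; case: corrRho => _ _ Rho1.
have := gZ (delta_mx i 0); rewrite /centered_normal.
have -> : qform Rho (delta_mx i 0) = 1.
  by rewrite /qform trmx_delta -rowE -colE !mxE Rho1.
rewrite oner_eq0 sqrtr1 => gZi A mA; rewrite -gZi//; congr (P (_ @^-1` A)).
by apply/funext => w; rewrite trmx_delta -rowE !mxE.
Qed.

(** If [|Z_i|] has integer part [k] and [s < |Z_i| / sqrt W], then [W < ((k+1)/s)^2]. By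
    independence this has probability at most a constant times [((k+1)/s)^kappa e^(-k^2/2)], which
    is summable in [k]. The constant is uniform in [i] because all coordinates are standard
    normal. *)
Lemma t_coord_tail : exists2 C : R, 0 <= C &
  forall i, tail_bound P (fun w => tnth (Z w) i / Num.sqrt (W w)) kappa C.
Proof.
have kappa0 : 0 < kappa by apply: lt_trans kappa2.
pose D := (2 `^ (kappa / 2) * Gamma (kappa / 2))^-1.
have D0 : 0 <= D by rewrite invr_ge0 mulr_ge0 ?powR_ge0 ?Gamma_ge0.
pose q : R := expR (- 2^-1).
have q01 : 0 <= q < 1 by rewrite expR_ge0/= -[ltRHS]expR0 ltr_expR oppr_lt0 invr_gt0.
pose G := 2 * normal_peak 1 * (D * kappa `^ (kappa / 2)) * (8 ^+ 4 * expR 1).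
have G0 : 0 <= G.
  by rewrite !mulr_ge0 ?powR_ge0 ?normal_peak_ge0 ?exprn_ge0 ?expR_ge0.
exists (G / (1 - q)) => [|i s s0].
  by rewrite divr_ge0// subr_ge0 ltW//; case/andP: q01.
case: dataWZ => lawW _ indWZ.
have mZ : measurable_fun [set: p.-tuple R] (fun z => tnth z i).
  exact: measurable_tnth.
(* A threshold for [kappa * W], the variable whose law is chi-squared. *)
pose u (k : nat) : R := kappa * (k.+1%:R / s) ^+ 2.
pose F k := (W @^-1` [set x | kappa * x < u k]) `&`
            (Z @^-1` [set z | annulus k (tnth z i)]).
have mWk k : measurable [set x : R | kappa * x < u k].
  rewrite (_ : mkset _ = ( *%R kappa) @^-1` `]-oo, u k[).
    by rewrite -[X in measurable X]setTI; apply: measurable_funM.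
  by apply/seteqP; split => x /=; rewrite in_itv.
have mZk k : measurable [set z : p.-tuple R | annulus k (tnth z i)].
  by rewrite -[X in measurable X]setTI; exact: mZ (measurable_annulus k).
have mF k : measurable (F k).
  by apply: measurableI; rewrite -[X in measurable X]setTI; exact: measurable_funP.
set A := [set w | _].
have mA : measurable A.
  apply: measurable_gt_norm; apply: measurable_funM => //.
    by apply: (measurableT_comp (measurable_tnth i)).
  exact: (measurableT_comp measurable_inv_sqrt).
have AF : A `<=` \bigcup_k F k.
  move=> w; rewrite /A/= normrM normfV (ger0_norm (sqrtr_ge0 _)) => sZ.
  (* If the root were [0], the quotient would be [0] by the convention [0^-1 = 0], contradicting
     [0 < s]. *)
  have sq0 : 0 < Num.sqrt (W w).
    rewrite lt_neqAle sqrtr_ge0 andbT; apply/eqP => sq0.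
    by move: sZ; rewrite -sq0 invr0 mulr0 ltNge ltW.
  have W0 : 0 < W w by rewrite -sqrtr_gt0.
  exists (Num.trunc `|tnth (Z w) i|) => //.
  have Zk : `|tnth (Z w) i| < (Num.trunc `|tnth (Z w) i|).+1%:R.
    exact: truncnS_gt.
  split; rewrite /= /annulus/=; last first.
    by rewrite Zk andbT truncn_le.
  rewrite /u ltr_pM2l// -[ltLHS]sqr_sqrtr ?(ltW W0)//.
  rewrite ltrXn2r// ?nnegrE ?divr_ge0 ?sqrtr_ge0 ?(ltW s0)//.
  rewrite ltr_pdivlMr// mulrC; apply: lt_trans Zk.
  by rewrite -ltr_pdivlMr.
apply: (@le_trans _ _ (\sum_(0 <= k <oo) P (F k))%E).
  exact: measure_sigma_subadditive.
rewrite mulrAC; apply: nneseries_le_geometric => //.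
  by rewrite mulr_ge0 ?powR_ge0.
move=> k; rewrite measure_ge0/= indWZ//.
apply: (@le_trans _ _ ((D * u k `^ (kappa / 2))%:E *
    (2 * normal_peak 1 * expR (- (k%:R ^+ 2) / 2))%:E)%E).
  apply: lee_pmul => //.
  - apply: le_trans (chi2_prob_lt_le kappa2 _); last first.
      by rewrite mulr_gt0// exprn_gt0// divr_gt0.
    rewrite -lawW// le_eqVlt; apply/orP; left; apply/eqP; congr (P _).
  - apply: le_trans (normal_prob_annulus_le k).
    by rewrite -(gaussian_coord_law i)//; exact: measurable_annulus.
rewrite -EFinM lee_fin.
have -> : u k `^ (kappa / 2) =
    kappa `^ (kappa / 2) * (k.+1%:R `^ kappa * s `^ (- kappa)).
  rewrite /u powRM ?sqr_ge0 ?(ltW kappa0)//; congr (_ * _).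
  have ks0 : 0 <= k.+1%:R / s by rewrite divr_ge0 ?(ltW s0).
  rewrite -powR_mulrn// -powRrM [2%:R * _]mulrC divfK//.
  rewrite powRM ?invr_ge0 ?(ltW s0)//; congr (_ * _).
  by rewrite -powR_inv1 ?(ltW s0)// -powRrM mulN1r.
rewrite [leLHS](_ : _ = 2 * normal_peak 1 * (D * kappa `^ (kappa / 2)) *
   s `^ (- kappa) * (expR (- (k%:R ^+ 2) / 2) * k.+1%:R `^ kappa)); last first.
  ring.
rewrite [leRHS](_ : _ = 2 * normal_peak 1 * (D * kappa `^ (kappa / 2)) *
   s `^ (- kappa) * (8 ^+ 4 * expR 1 * q ^+ k)); last by rewrite /G; ring.
apply: ler_wpM2l; first by rewrite !mulr_ge0 ?powR_ge0 ?normal_peak_ge0.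
by apply: gauss_powR_geometric => //; exact: ltW.
Qed.

Lemma skew_t_coord_tail : exists2 C : R, 0 <= C &
  forall i, tail_bound P (fun w => tnth (skew_t_vector alpha W Z w) i) kappa C.
Proof.
have [C C0 tailT] := t_coord_tail.
pose delta := alpha / Num.sqrt (1 + alpha ^+ 2).
(* A factor with [|X_i| <= b |T_i|]; the summand [1] makes its positivity immediate. *)
pose b := 1 + `|delta| + Num.sqrt (1 - delta ^+ 2).
have b0 : 0 < b by rewrite !ltr_pwDl.
exists (C * b `^ kappa) => [|i s s0]; first by rewrite mulr_ge0 ?powR_ge0.
have sb0 : 0 < s / b by rewrite divr_gt0.
apply: (@le_trans _ _ (C * (s / b) `^ (- kappa))%:E); last first.
  rewrite lee_fin powRM ?invr_ge0 ?(ltW s0) ?(ltW b0)//.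
  by rewrite -(powR_inv1 (ltW b0)) -[b `^ _ `^ _]powRrM mulrNN mul1r mulrAC mulrA.
apply: le_trans (tailT i _ sb0).
apply: le_measure; rewrite ?inE.
- by apply: measurable_gt_norm; exact: measurable_skew_t_coord.
- apply: measurable_gt_norm; apply: measurable_funM => //.
    by apply: (measurableT_comp (measurable_tnth i)).
  exact: (measurableT_comp measurable_inv_sqrt).
move=> w /=; rewrite tnth_mktuple -/delta; set t := _ / _ => sX.
rewrite ltr_pdivrMr//; apply: lt_le_trans sX _.
apply: le_trans (ler_normD _ _) _; rewrite (normrM delta) (normrM (Num.sqrt _)) normr_id.
rewrite (ger0_norm (sqrtr_ge0 _)) -mulrDl mulrC ler_wpM2l//.
by rewrite /b lerD2r lerDr.
Qed.

End SkewTTail.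

(** * Spectral norm and perturbation of the minimum-variance portfolio *)

Lemma cvg_big_sum (R : realType) (I : Type) (r : seq I) (u : I -> nat -> R)
    (l : I -> R) : (forall i, u i k @[k --> \oo] --> l i) ->
  \sum_(i <- r) u i k @[k --> \oo] --> \sum_(i <- r) l i.
Proof.
move=> ul; elim: r => [|i r IH].
  by rewrite big_nil; under eq_fun do rewrite big_nil; exact: cvg_cst.
rewrite big_cons; under eq_fun do rewrite big_cons.
exact: (cvgD (ul i) IH).
Qed.

Section MatrixPerturbation.
Context {R : realType} {p : nat}.
Implicit Types (S E : 'M[R]_p) (x y h u : 'cV[R]_p).

(** Its stochastic order reduces to that of single entries. It dominates the spectral norm and
    controls bilinear forms through coordinatewise bounds, so the perturbation argument is run with
    it. *)
Definition entry_norm E : R := \sum_i \sum_j `|E i j|.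

Lemma entry_norm_ge0 E : 0 <= entry_norm E.
Proof. by apply: sumr_ge0 => i _; apply: sumr_ge0. Qed.

Lemma bilin_formE E x y : (x^T *m E *m y) 0 0 = \sum_i \sum_j x i 0 * E i j * y j 0.
Proof.
rewrite mxE exchange_big/=; apply: eq_bigr => j _.
by rewrite mxE mulr_suml; apply: eq_bigr => i _; rewrite mxE.
Qed.

Lemma bilin_form_le E x y (a b : R) :
  (forall i, `|x i 0| <= a) -> (forall i, `|y i 0| <= b) ->
  `|(x^T *m E *m y) 0 0| <= entry_norm E * (a * b).
Proof.
move=> xa yb; rewrite bilin_formE /entry_norm mulr_suml.
apply: le_trans (ler_norm_sum _ _ _) _; apply: ler_sum => i _.
rewrite mulr_suml.
apply: le_trans (ler_norm_sum _ _ _) _; apply: ler_sum => j _.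
by rewrite -mulrA mulrCA !normrM ler_wpM2l// ler_pM.
Qed.

Lemma enorm_ge0 x : 0 <= enorm x.
Proof. exact: sqrtr_ge0. Qed.

Lemma sqr_enorm x : enorm x ^+ 2 = \sum_i x i 0 ^+ 2.
Proof. by rewrite sqr_sqrtr// sumr_ge0// => i _; exact: sqr_ge0. Qed.

Lemma enorm0 : enorm (0 : 'cV[R]_p) = 0.
Proof. by rewrite /enorm big1 ?sqrtr0// => i _; rewrite mxE expr0n. Qed.

Lemma norm_le_enorm x i : `|x i 0| <= enorm x.
Proof.
rewrite -(@ler_pXn2r _ 2) ?nnegrE ?enorm_ge0// sqr_enorm real_normK ?num_real//.
by rewrite (bigD1 i)//= lerDl sumr_ge0// => j _; exact: sqr_ge0.
Qed.

Lemma enorm_le_sum x : enorm x <= \sum_i `|x i 0|.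
Proof.
have s0 : 0 <= \sum_i `|x i 0| by exact: sumr_ge0.
rewrite -(@ler_pXn2r _ 2) ?nnegrE ?enorm_ge0// sqr_enorm expr2 mulr_suml.
apply: ler_sum => i _; rewrite -real_normK ?num_real// expr2 ler_wpM2l//.
by rewrite (bigD1 i)//= lerDl sumr_ge0.
Qed.

Lemma enorm_mulmx_le E x : enorm (E *m x) <= entry_norm E * enorm x.
Proof.
apply: le_trans (enorm_le_sum _) _; rewrite mulr_suml; apply: ler_sum => i _.
rewrite mxE mulr_suml; apply: le_trans (ler_norm_sum _ _ _) _.
by apply: ler_sum => j _; rewrite normrM ler_wpM2l// norm_le_enorm.
Qed.

Let images E := [set enorm (E *m x) | x in [set x : 'cV[R]_p | enorm x <= 1]].

Let images0 E : images E 0.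
Proof. by exists 0; rewrite /= ?mulmx0 enorm0 ?ler01. Qed.

Let images_ub E : ubound (images E) (entry_norm E).
Proof.
move=> _ [x /= x1 <-]; apply: le_trans (enorm_mulmx_le _ _) _.
by rewrite ler_piMr ?entry_norm_ge0.
Qed.

Lemma spectral_norm_ge0 E : 0 <= spectral_norm E.
Proof. by apply: (ub_le_sup _ (images0 E)); exists (entry_norm E). Qed.

Lemma spectral_norm_le E : spectral_norm E <= entry_norm E.
Proof. apply: ge_sup; last exact: images_ub. by exists 0; exact: images0. Qed.

Lemma enormZ (k : R) x : enorm (k *: x) = `|k| * enorm x.
Proof.
apply: (@pexpIrn _ 2) => //; rewrite ?nnegrE ?mulr_ge0 ?enorm_ge0//.
rewrite exprMn !sqr_enorm real_normK ?num_real// mulr_sumr.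
by apply: eq_bigr => i _; rewrite mxE exprMn.
Qed.

(* Homogeneity removes the constraint [enorm x <= 1], after which the open
   condition can be tested on rational vectors, that is, countably often. *)
Lemma lt_spectral_norm E (c : R) : 0 <= c ->
  (c < spectral_norm E) <->
  exists q : 'cV[rat]_p, let y := map_mx ratr q in
    c ^+ 2 * (\sum_i y i 0 ^+ 2) < \sum_i (E *m y) i 0 ^+ 2.
Proof.
move=> c0; split=> [cE|[q /= qP]]; last first.
  set y := map_mx ratr q in qP.
  move: qP; rewrite -!sqr_enorm -exprMn ltr_pXn2r ?nnegrE ?mulr_ge0 ?enorm_ge0//.
  move=> cy.
  (* Needed to normalise [y]: were [y] zero, [E *m y] would vanish too, against the strict
     inequality [cy]. *)
  have y0 : 0 < enorm y.
    rewrite lt_neqAle enorm_ge0 andbT; apply/eqP => y0.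
    have := enorm_mulmx_le E y; rewrite -y0 mulr0 leNgt => /negP; apply.
    by rewrite (le_lt_trans _ cy)// mulr_ge0 ?enorm_ge0.
  apply: (@lt_le_trans _ _ (enorm (E *m ((enorm y)^-1 *: y)))).
    rewrite -scalemxAr enormZ ger0_norm ?invr_ge0 ?enorm_ge0//.
    by rewrite mulrC ltr_pdivlMr.
  apply: ub_le_sup; first by exists (entry_norm E); exact: images_ub.
  exists ((enorm y)^-1 *: y) => //=.
  by rewrite enormZ ger0_norm ?invr_ge0 ?enorm_ge0// mulVf// gt_eqF.
have [_ [x /= x1 <-] cx] := sup_gt (ex_intro _ 0 (images0 E)) cE.
(* A polynomial in the coordinates, positive at the real vector [x], hence positive at a rational
   vector close enough to it. *)
pose phi x := \sum_i (\sum_j E i j * x j 0) ^+ 2 - c ^+ 2 * (\sum_i x i 0 ^+ 2).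
have phix : 0 < phi x.
  rewrite subr_gt0 (_ : \sum_i (\sum_j _) ^+ 2 = enorm (E *m x) ^+ 2); last first.
    by rewrite sqr_enorm; apply: eq_bigr => i _; rewrite mxE.
  rewrite -sqr_enorm -exprMn ltr_pXn2r ?nnegrE ?mulr_ge0 ?enorm_ge0//.
  by apply: le_lt_trans cx; rewrite ler_piMr.
have /choice[q qP] : forall ki : nat * 'I_p, exists r : rat,
    `|x ki.2 0 - ratr r| < ki.1.+1%:R^-1.
  move=> [k i] /=.
  have [|r] := @rat_in_itvoo R (x i 0 - k.+1%:R^-1) (x i 0 + k.+1%:R^-1).
    by rewrite ltrD2l gtrN// invr_gt0.
  rewrite in_itv/= => /andP[xr rx]; exists r.
  by rewrite ltr_distlC xr.
pose y (k : nat) : 'cV[rat]_p := \col_i q (k, i).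
have ycvg i : (map_mx ratr (y k) : 'cV[R]_p) i 0 @[k --> \oo] --> x i 0.
  apply/cvgrPdist_lt => e e0.
  near=> k; rewrite !mxE; apply: lt_trans (qP (k, i)) _ => /=.
  by near: k; exact: near_infty_natSinv_lt (PosNum e0).
have phicvg : phi (map_mx ratr (y k)) @[k --> \oo] --> phi x.
  have cvg_sqr (v : nat -> R) (l : R) : v k @[k --> \oo] --> l ->
      v k ^+ 2 @[k --> \oo] --> l ^+ 2 by move=> vl; exact: (cvgM vl vl).
  apply: cvgB.
    apply: cvg_big_sum => i; apply: cvg_sqr; apply: cvg_big_sum => j.
    by apply: cvgM; [exact: cvg_cst|exact: ycvg].
  apply: cvgM; first exact: cvg_cst.
  by apply: cvg_big_sum => i; apply: cvg_sqr; exact: ycvg.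
have [k _ /(_ k (leqnn k)) phik] := cvgr_gt _ phicvg _ phix.
exists (y k) => /=; move: phik; rewrite /= /phi subr_gt0.
by move/lt_le_trans; apply; apply: ler_sum => i _; rewrite [in leRHS]mxE.
Unshelve. all: by end_near. Qed.

Lemma qform_perturb S E x : qform (S + E) x = qform S x + (x^T *m E *m x) 0 0.
Proof. by rewrite /qform mulmxDr mulmxDl mxE. Qed.

(** For positive definite [S], the trace of the inverse dominates the reciprocal of the smallest
    eigenvalue and takes its place in the bounds. *)
Definition inv_trace S : R := \sum_i invmx S i i.

(* Cauchy-Schwarz in the inner product of [S], applied to [h] and to
   [S^-1 e_i], whose inner product is [h i]. *)
Lemma sqr_coord_le_qform S h i : posdefmx S ->
  0 <= inv_trace S /\ h i 0 ^+ 2 <= inv_trace S * qform S h.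
Proof.
move=> Spd; have Su := posdefmx_unit Spd; have [St Spos] := Spd.
have q0 x : 0 <= qform S x.
  by have [->|/Spos/ltW//] := eqVneq x 0; rewrite /qform mulmx0 mxE.
pose u j : 'cV[R]_p := invmx S *m delta_mx j 0.
have Su1 j : S *m u j = delta_mx j 0 by rewrite mulmxA mulmxV// mul1mx.
have qu j : qform S (u j) = invmx S j j.
  rewrite /qform -mulmxA Su1 trmx_mul trmx_inv St trmx_delta -mulmxA.
  by rewrite -rowE -colE !mxE.
have vle : invmx S i i <= inv_trace S.
  by rewrite /inv_trace (bigD1 i)//= lerDl sumr_ge0// => j _; rewrite -qu.
have v0 : 0 <= inv_trace S by apply: sumr_ge0 => j _; rewrite -qu.
split=> //; apply: (@le_trans _ _ (invmx S i i * qform S h)); last first.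
  by rewrite ler_wpM2r.
have u0 : u i != 0.
  apply/eqP => u0; have := Su1 i; rewrite u0 mulmx0 => /matrixP/(_ i 0).
  by rewrite !mxE !eqxx => /eqP; rewrite eq_sym oner_eq0.
have qu0 := Spos _ u0; rewrite -qu.
have hu : (h^T *m S *m u i) 0 0 = h i 0.
  by rewrite -mulmxA Su1 -colE !mxE.
have uh : ((u i)^T *m S *m h) 0 0 = h i 0.
  have -> : (u i)^T *m S = (delta_mx i 0)^T.
    by rewrite -[LHS]trmxK trmx_mul St trmxK Su1.
  by rewrite trmx_delta -rowE mxE.
(* [k *: u i] is the orthogonal projection of [h] on [u i] for the inner product of [S]. *)
pose k := h i 0 / qform S (u i).
have := q0 (h - k *: u i).
have -> : qform S (h - k *: u i) = qform S h - h i 0 ^+ 2 / qform S (u i).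
  rewrite {1}/qform.
  have -> : (h - k *: u i)^T = h^T - k *: (u i)^T.
    by apply/matrixP => a b; rewrite !mxE.
  have entryB (A B : 'M[R]_1) : (A - B) 0 0 = A 0 0 - B 0 0 by rewrite !mxE.
  have entryZ a (A : 'M[R]_1) : (a *: A) 0 0 = a * A 0 0 by rewrite mxE.
  rewrite !mulmxBl !mulmxBr -!scalemxAl -!scalemxAr !entryB !entryZ.
  rewrite hu uh -!/(qform S _) /k.
  by field; rewrite gt_eqF.
by rewrite subr_ge0 ler_pdivrMr// mulrC.
Qed.

Lemma coord_le_qform S h i : posdefmx S ->
  `|h i 0| <= Num.sqrt (inv_trace S * qform S h).
Proof.
move=> /(sqr_coord_le_qform h i)[v0 hv].
by rewrite -sqrtr_sqr ler_wsqrtr.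
Qed.

(** The coordinate bounds give [|x^T E x| <= (x^T S x) / 2], so the perturbed form keeps at least
    half of its value. *)
Lemma posdefmx_perturb S E : (0 < p)%N -> posdefmx S -> E^T = E ->
  entry_norm E * inv_trace S <= 2^-1 -> posdefmx (S + E).
Proof.
move=> p0 Spd Et small; have [St Spos] := Spd; split=> [|x x0].
  by rewrite linearD/= St Et.
have qx := Spos _ x0.
have v0 : 0 <= inv_trace S.
  by have [] := sqr_coord_le_qform x (Ordinal p0) Spd.
have := bilin_form_le E (fun i => coord_le_qform x i Spd)
  (fun i => coord_le_qform x i Spd).
rewrite -expr2 sqr_sqrtr ?mulr_ge0 ?(ltW qx)// mulrA => xEx.
rewrite qform_perturb -ltrBlDr sub0r.
apply: (@le_lt_trans _ _ (2^-1 * qform S x)); last first.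
  by rewrite gtr_pMl// invf_lt1// ltr1n.
apply: le_trans (ler_norm _) _; rewrite normrN; apply: le_trans xEx _.
by rewrite ler_wpM2r// ltW.
Qed.

(** The Lagrange condition for the budget constraint; the multiplier is the minimal variance
    itself. *)
Lemma gmv_spec S : (0 < p)%N -> posdefmx S ->
  ones^T *m gmv S = 1%:M /\ S *m gmv S = qform S (gmv S) *: ones.
Proof.
move=> p0 Spd; have Su := posdefmx_unit Spd; have [St Spos] := Spd.
rewrite gmvE//; set c := (_ *m _ *m _) 0 0; set v := invmx S *m ones.
have Sv : S *m v = ones by rewrite mulmxA mulmxV ?mul1mx.
have v0 : v != 0.
  apply/eqP => v0; move: Sv; rewrite v0 mulmx0.
  move/matrixP/(_ (Ordinal p0) 0); rewrite !mxE => /eqP.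
  by rewrite eq_sym oner_eq0.
have cE : ones^T *m v = c%:M by rewrite [LHS]mx11_scalar /v mulmxA.
have vS : v^T *m ones = c%:M.
  by rewrite -[v^T *m _]trmxK trmx_mul trmxK cE tr_scalar_mx.
have vc : qform S v = c by rewrite /qform -mulmxA Sv vS mxE eqxx.
have c0 : c != 0 by rewrite -vc gt_eqF// Spos.
have w1 : ones^T *m (c^-1 *: v) = 1%:M.
  by rewrite -scalemxAr cE scale_scalar_mx mulVf.
split=> //; rewrite -scalemxAr Sv; congr (_ *: _).
rewrite /qform -mulmxA -scalemxAr Sv.
have -> : (c^-1 *: v)^T = c^-1 *: v^T by rewrite linearZ.
by rewrite -scalemxAl -scalemxAr vS !mxE eqxx mulr1n mulVf// mulr1.
Qed.

(** With [q = h^T S h], smallness of [E] gives [|h^T E h| <= q / 2], which is absorbed on the left,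
    and [|h^T E w| <= N B sqrt(V q)]. Hence [q <= 2 N B sqrt(V q)]; squaring and cancelling a
    nonzero [q] yields the bound. *)
Lemma regret_perturb S E : (0 < p)%N -> posdefmx S -> E^T = E ->
  entry_norm E * inv_trace S <= 2^-1 ->
  0 <= regret S (S + E) <=
    4 * inv_trace S * enorm (gmv S) ^+ 2 * entry_norm E ^+ 2.
Proof.
move=> p0 Spd Et small; have SEpd := posdefmx_perturb p0 Spd Et small.
have [w1 Sw] := gmv_spec p0 Spd; have [v1 SEv] := gmv_spec p0 SEpd.
set w := gmv S in w1 Sw *; set v := gmv (S + E) in v1 SEv *.
(* The first-order term vanishes: [S *m w] is a multiple of [ones], and both portfolios have total
   weight [1]. *)
have regE : regret S (S + E) = qform S (v - w).
  by rewrite /regret -/w -/v (gmv_split Spd Sw w1 v1) addrAC subrr add0r.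
rewrite regE; set h := v - w.
have vE : v = w + h by rewrite subrKC.
have h1 : h^T *m (ones : 'cV[R]_p) = 0.
  rewrite -[h^T *m _]trmxK trmx_mul trmxK mulmxBr w1 v1 subrr.
  exact: trmx0.
have hS : h^T *m S *m w = 0 by rewrite -mulmxA Sw -scalemxAr h1 scaler0.
have hSE : h^T *m (S + E) *m v = 0 by rewrite -mulmxA SEv -scalemxAr h1 scaler0.
have qE : qform S h = - (h^T *m E *m w) 0 0 - (h^T *m E *m h) 0 0.
  have : h^T *m S *m h = - (h^T *m E *m w) - h^T *m E *m h.
    apply/eqP; rewrite -opprD -addr_eq0 -mulmxDr -vE.
    have <- : h^T *m S *m v = h^T *m S *m h by rewrite vE mulmxDr hS add0r.
    by rewrite -mulmxDl -mulmxDr hSE.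
  by rewrite /qform => ->; rewrite !mxE.
have [St Spos] := Spd.
have q0 : 0 <= qform S h.
  by have [->|/Spos/ltW//] := eqVneq h 0; rewrite /qform mulmx0 mxE.
have V0 : 0 <= inv_trace S by have [] := sqr_coord_le_qform h (Ordinal p0) Spd.
rewrite q0/=; set V := inv_trace S in small V0 *; set N := entry_norm E in small *.
set q := qform S h in qE q0 *; set B := enorm w.
have N0 : 0 <= N by exact: entry_norm_ge0.
have B0 : 0 <= B by exact: enorm_ge0.
have hc i : `|h i 0| <= Num.sqrt (V * q) by exact: coord_le_qform.
have hEh : `|(h^T *m E *m h) 0 0| <= 2^-1 * q.
  apply: le_trans (bilin_form_le _ hc hc) _.
  by rewrite -expr2 sqr_sqrtr ?mulr_ge0// mulrA ler_wpM2r.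
have hEw : `|(h^T *m E *m w) 0 0| <= N * (Num.sqrt (V * q) * B).
  exact: bilin_form_le hc (norm_le_enorm w).
have q_le : q <= 2 * (N * (Num.sqrt (V * q) * B)).
  move: hEh hEw; rewrite !ler_norml => /andP[h2 _] /andP[h3 _].
  move: h2 h3 qE; set K := N * _; set ew := (_ *m w) 0 0.
  by set eh := (_ *m h) 0 0; lra.
have [->|qn0] := eqVneq q 0; first by rewrite !mulr_ge0 ?sqr_ge0.
have qgt0 : 0 < q by rewrite lt_neqAle eq_sym qn0.
rewrite -(ler_pM2r qgt0) -expr2.
rewrite [leRHS](_ : _ = (2 * (N * (Num.sqrt (V * q) * B))) ^+ 2).
  by rewrite lerXn2r ?nnegrE// !mulr_ge0 ?sqrtr_ge0.
have sq : Num.sqrt (V * q) ^+ 2 = V * q by rewrite sqr_sqrtr ?mulr_ge0.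
rewrite [RHS](_ : _ = 4 * N ^+ 2 * B ^+ 2 * Num.sqrt (V * q) ^+ 2); last ring.
by rewrite sq; ring.
Qed.

End MatrixPerturbation.

(** * Stochastic boundedness *)

Section BigOInProbability.
Context {R : realType} {d : measure_display} {Omega : measurableType d}.
Variable P : probability Omega R.
Implicit Types (Y : nat -> Omega -> R) (a b : nat -> R).

(** The common core of the [O_P] calculus: a deterministic implication between bounds, plus a union
    bound with [eps / 2] for each input. For [Y] only exceedance sets at nonnegative levels must be
    measurable, the form available for the spectral norm. *)
Lemma stoch_bigO_dominated Y1 Y2 Y a b :
  (forall n, measurable_fun setT (Y1 n)) ->
  (forall n, measurable_fun setT (Y2 n)) ->
  (forall n (c : R), 0 <= c -> measurable [set w | c < `|Y n w|]) ->
  (forall n, 0 <= b n) ->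
  (forall M1 M2, exists (M : R) (N : nat), forall n w, (N <= n)%N ->
     `|Y1 n w| <= M1 * a n -> `|Y2 n w| <= M2 * a n -> `|Y n w| <= M * b n) ->
  stoch_bigO P Y1 a -> stoch_bigO P Y2 a -> stoch_bigO P Y b.
Proof.
move=> mY1 mY2 mY b0 dom O1 O2 eps eps0.
have eps20 : 0 < eps / 2 by rewrite divr_gt0.
have [M1 [N1 H1]] := O1 _ eps20; have [M2 [N2 H2]] := O2 _ eps20.
have [M [N HM]] := dom M1 M2.
(* The absolute value makes the level nonnegative, as [mY] requires. *)
exists `|M|, (maxn N (maxn N1 N2)) => n.
rewrite !geq_max => /and3P[Nn N1n N2n].
pose A1 := [set w | M1 * a n < `|Y1 n w|].
pose A2 := [set w | M2 * a n < `|Y2 n w|].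
have mA1 : measurable A1 by exact: measurable_gt_norm.
have mA2 : measurable A2 by exact: measurable_gt_norm.
apply: (@le_trans _ _ (P (A1 `|` A2))).
  apply: le_measure; rewrite ?inE; [|exact: measurableU|].
    by apply: mY; rewrite mulr_ge0.
  move=> w /= MY; apply: contrapT => /not_orP[/negP]; rewrite -leNgt => Y1a.
  move=> /negP; rewrite -leNgt => Y2a.
  have := HM n w Nn Y1a Y2a; rewrite leNgt => /negP; apply.
  by apply: le_lt_trans MY; rewrite ler_wpM2r// ler_norm.
apply: le_trans (measureU2 _ mA1 mA2) _.
by rewrite [eps]splitr EFinD; apply: leeD; [exact: H1|exact: H2].
Qed.

Lemma stoch_bigOD Y1 Y2 a :
  (forall n, measurable_fun setT (Y1 n)) ->
  (forall n, measurable_fun setT (Y2 n)) -> (forall n, 0 <= a n) ->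
  stoch_bigO P Y1 a -> stoch_bigO P Y2 a ->
  stoch_bigO P (fun n w => Y1 n w + Y2 n w) a.
Proof.
move=> mY1 mY2 a0; apply: stoch_bigO_dominated => //.
  by move=> n c _; apply: measurable_gt_norm; exact: measurable_funD.
move=> M1 M2; exists (M1 + M2), 0%N => n w _ Y1a Y2a.
by apply: le_trans (ler_normD _ _) _; rewrite mulrDl lerD.
Qed.

(** The product is even of order [a^2], which is at most [a] when [a <= 1]. *)
Lemma stoch_bigOM Y1 Y2 a :
  (forall n, measurable_fun setT (Y1 n)) ->
  (forall n, measurable_fun setT (Y2 n)) -> (forall n, 0 <= a n <= 1) ->
  stoch_bigO P Y1 a -> stoch_bigO P Y2 a ->
  stoch_bigO P (fun n w => Y1 n w * Y2 n w) a.
Proof.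
move=> mY1 mY2 a01; apply: stoch_bigO_dominated => //.
- by move=> n c _; apply: measurable_gt_norm; exact: measurable_funM.
- by move=> n; case/andP: (a01 n).
move=> M1 M2; exists (`|M1| * `|M2|), 0%N => n w _ Y1a Y2a.
have /andP[a0 a1] := a01 n.
apply: (@le_trans _ _ ((`|M1| * a n) * (`|M2| * a n))).
  rewrite normrM ler_pM//; [apply: le_trans Y1a _|apply: le_trans Y2a _];
    by rewrite ler_wpM2r// ler_norm.
rewrite mulrACA ler_wpM2l ?mulr_ge0//.
by rewrite -[leRHS]mulr1 ler_wpM2l.
Qed.

Lemma stoch_bigOZ Y (c : R) a :
  (forall n, measurable_fun setT (Y n)) -> (forall n, 0 <= a n) ->
  stoch_bigO P Y a -> stoch_bigO P (fun n w => c * Y n w) a.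
Proof.
move=> mY a0 OY; apply: (stoch_bigO_dominated _ _ _ _ _ OY OY) => //.
  by move=> n e _; apply: measurable_gt_norm; exact: measurable_funM.
move=> M1 M2; exists (`|c| * M1), 0%N => n w _ Ya _.
by rewrite normrM -mulrA ler_wpM2l.
Qed.

Lemma stoch_bigO_normr Y a : stoch_bigO P Y a ->
  stoch_bigO P (fun n w => `|Y n w|) a.
Proof.
move=> OY eps /OY[M [N H]]; exists M, N => n /H.
by under [X in _ -> (P X <= _)%E]eq_set do rewrite normr_id.
Qed.

Lemma stoch_bigO_sum (I : Type) (r : seq I) (Y : I -> nat -> Omega -> R) a :
  (forall i n, measurable_fun setT (Y i n)) -> (forall n, 0 <= a n) ->
  (forall i, stoch_bigO P (Y i) a) ->
  stoch_bigO P (fun n w => \sum_(i <- r) Y i n w) a.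
Proof.
move=> mY a0 OY; elim: r => [|i r IH].
  move=> eps eps0; exists 0, 0%N => n _.
  rewrite (_ : mkset _ = set0) ?measure0 ?lee_fin ?(ltW eps0)//.
  by apply/seteqP; split => w //=; rewrite big_nil normr0 mul0r ltxx.
have := stoch_bigOD (mY i) (fun n => measurable_sum _ (fun i => mY i n)) a0 (OY i) IH.
congr (stoch_bigO P _ a); apply/funext => n; apply/funext => w.
by rewrite big_cons.
Qed.

End BigOInProbability.

(** By [lt_spectral_norm] the event is a countable union, over rational vectors, of polynomial
    inequalities in the entries. *)
Lemma measurable_spectral_norm_gt (R : realType) (p : nat)
    (d : measure_display) (Omega : measurableType d) (E : Omega -> 'M[R]_p)
    (c : R) : 0 <= c ->
  (forall i j, measurable_fun setT (fun w => E w i j)) ->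
  measurable [set w | c < `|spectral_norm (E w)|].
Proof.
move=> c0 mE.
pose y (q : 'cV[rat]_p) : 'cV[R]_p := map_mx ratr q.
pose A q := [set w | c ^+ 2 * (\sum_i y q i 0 ^+ 2)
                     < \sum_i (E w *m y q) i 0 ^+ 2].
rewrite (_ : mkset _ = \bigcup_q A q); last first.
  apply/seteqP; split => [w /=|w [q _ wq]] /=.
    by rewrite ger0_norm ?spectral_norm_ge0// => /(lt_spectral_norm _ c0)[q]; exists q.
  rewrite ger0_norm ?spectral_norm_ge0//.
  by apply/(lt_spectral_norm _ c0); exists q.
apply: countable_bigcupT_measurable => [|q]; first exact: countableP.
pose f w := \sum_i (\sum_j E w i j * y q j 0) ^+ 2.
have mf : measurable_fun setT f.
  apply: measurable_sum => i; apply: measurable_funX; apply: measurable_sum => j.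
  exact: measurable_funM.
rewrite (_ : A q = f @^-1` `]c ^+ 2 * (\sum_i y q i 0 ^+ 2), +oo[).
  by rewrite -[X in measurable X]setTI; exact: mf.
have fE w : \sum_i (E w *m y q) i 0 ^+ 2 = f w.
  by apply: eq_bigr => i _; rewrite mxE.
by apply/seteqP; split => w; rewrite /A/= in_itv/= andbT fE.
Qed.

(** * Sample means and covariances *)

Definition mfun_of (d d' : measure_display) (T : measurableType d)
    (T' : measurableType d') (f : T -> T') (mf : measurable_fun setT f) :
    {mfun T >-> T'} :=
  MeasurableFun.Pack (MeasurableFun.Class (isMeasurableFun.Build _ _ _ _ _ mf)).

Section IIDMeans.
Context {R : realType} {d0 d dE : measure_display}.
Context {Omega0 : measurableType d0} {Omega : measurableType d}.
Context {E : measurableType dE}.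
Variables (P0 : probability Omega0 R) (P : probability Omega R).
Variables (X0 : Omega0 -> E) (X : nat -> {RV P >-> E}).
Hypothesis mX0 : measurable_fun setT X0.
Hypothesis lawX : forall t, has_law P (X t) (pushforward P0 X0).
Hypothesis indX : mutually_independent P X.

Lemma pairwise_independent s t (f : E -> R) (mf : measurable_fun setT f) :
  s != t -> independent2 P (f \o X s) (f \o X t).
Proof.
move=> st A B mA mB.
pose F k := if k == s then f @^-1` A else f @^-1` B.
have mF k : measurable (F k).
  by rewrite /F; case: ifP => _; rewrite -[X in measurable X]setTI; exact: mf.
have := indX [fset s; t]%fset mF.
rewrite (perm_big [:: s; t]); last first.
  apply: uniq_perm; rewrite ?fset_uniq//= ?inE ?st// => k.
  by rewrite !inE.
rewrite !big_cons big_nil /= mule1 {2 3}/F eqxx eq_sym (negbTE st) => <-.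
congr (P _); apply/seteqP; split => w /=.
  move=> [As Bt] k /=; rewrite !inE => /orP[]/eqP ->; rewrite /F ?eqxx//.
  by rewrite eq_sym (negbTE st).
move=> H; split.
  by have := H s; rewrite /= !inE eqxx /F eqxx; apply.
by have := H t; rewrite /= !inE eqxx orbT /F eq_sym (negbTE st); apply.
Qed.

(** The weak law for a function of the sample, with the expectation moved to the model space through
    the common law. *)
Lemma iid_mean_bigO (f : E -> R) (a C : R) : measurable_fun setT f ->
  1 < a -> a < 2 -> 0 <= C -> tail_bound P0 (f \o X0) a C ->
  P0.-integrable setT (EFin \o (f \o X0)) /\
  stoch_bigO P
    (fun n w => n%:R^-1 * (\sum_(t < n) f (X t w)) - \int[P0]_w f (X0 w))
    (fun n => n%:R `^ (- (1 - a^-1))).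
Proof.
move=> mf a1 a2 C0 tailf.
have mfX0 : measurable_fun setT (f \o X0) by exact: measurableT_comp.
have mfX t : measurable_fun setT (f \o X t) by exact: measurableT_comp.
pose V0 : {RV P0 >-> R} := mfun_of mfX0.
pose U t : {RV P >-> R} := mfun_of (mfX t).
have int0 : P0.-integrable setT (EFin \o (f \o X0)).
  exact: (@integrable_tail_bound _ _ _ P0 V0 a C 1).
split=> //.
have lawX' : has_law P (X 0%N) (pushforward P0 (mfun_of mX0)) by exact: lawX.
have -> : \int[P0]_w f (X0 w) = \int[P]_w U 0%N w.
  exact/esym/(Rintegral_same_law lawX').
apply: (stoch_bigO_mean (U := U) a1 a2 C0).
- by move=> s t; exact: pairwise_independent.
- move=> t A mA; rewrite /pushforward.
  have mfA : measurable (f @^-1` A) by rewrite -[X in measurable X]setTI; exact: mf.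
  exact: etrans (lawX t mfA) (esym (lawX 0%N mfA)).
- move=> s s0; have := tailf s s0; congr (_ <= _)%E; apply/esym.
  have -> : [set w | s < `|U 0%N w|] = X 0%N @^-1` [set x | s < `|f x|] by [].
  by rewrite lawX//; exact: measurable_gt_norm.
Qed.

End IIDMeans.

(** * Tail index of coordinates and of their products *)

Section ProductTails.
Context {R : realType} {d : measure_display} {Omega : measurableType d}.
Variable P : probability Omega R.

(** Brings single coordinates to the index of the products. For [s < 1] the probability is at most
    [1 <= s^(-kappa/2)], which accounts for the [+ 1]. *)
Lemma tail_bound_half (V : Omega -> R) (kappa C : R) :
  measurable_fun setT V -> 0 < kappa -> 0 <= C ->
  tail_bound P V kappa C -> tail_bound P V (kappa / 2) (C + 1).
Proof.
move=> mV k0 C0 tV s s0; have [s1|s1] := leP 1 s.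
  apply: le_trans (tV s s0) _; rewrite lee_fin ler_pM ?powR_ge0// ?lerDl//.
  by rewrite ler_powR// lerN2 ler_pdivrMr// ler_pMr// ler1n.
apply: (@le_trans _ _ 1%E); first exact/probability_le1/measurable_gt_norm.
rewrite lee_fin -[leLHS]mulr1 ler_pM ?lerDr//.
rewrite powRN invf_ge1 ?powR_gt0// [leRHS](_ : 1 = 1 `^ (kappa / 2)).
  by rewrite ge0_ler_powR ?nnegrE ?(ltW s0) ?(ltW s1)// divr_ge0// ltW.
by rewrite powR1.
Qed.

(** If [|U V| > s], then [|U|] or [|V|] exceeds [sqrt s]. *)
Lemma tail_bound_mul (U V : Omega -> R) (kappa C : R) :
  measurable_fun setT U -> measurable_fun setT V ->
  tail_bound P U kappa C -> tail_bound P V kappa C ->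
  tail_bound P (fun w => U w * V w) (kappa / 2) (2 * C).
Proof.
move=> mU mV tU tV s s0; have q0 : 0 < Num.sqrt s by rewrite sqrtr_gt0.
pose A (Y : Omega -> R) := [set w | Num.sqrt s < `|Y w|].
have mA Y : measurable_fun setT Y -> measurable (A Y) by exact: measurable_gt_norm.
apply: (@le_trans _ _ (P (A U `|` A V))).
  apply: le_measure; rewrite ?inE; [|by apply: measurableU; exact: mA|].
    by apply: measurable_gt_norm; exact: measurable_funM.
  move=> w /= sUV; apply: contrapT => /not_orP[/negP]; rewrite -leNgt => Us.
  move=> /negP; rewrite -leNgt => Vs.
  move: sUV; rewrite ltNge => /negP; apply.
  by rewrite normrM -[leRHS](sqr_sqrtr (ltW s0)) expr2 ler_pM.
apply: le_trans (measureU2 _ (mA _ mU) (mA _ mV)) _.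
apply: (@le_trans _ _ ((C * Num.sqrt s `^ (- kappa))%:E +
                       (C * Num.sqrt s `^ (- kappa))%:E)%E).
  by apply: leeD; [exact: tU|exact: tV].
rewrite -EFinD lee_fin -powR12_sqrt ?(ltW s0)// -powRrM mulrN.
rewrite [2^-1 * _]mulrC le_eqVlt; apply/orP; left; apply/eqP; ring.
Qed.

End ProductTails.

Lemma sample_cov_sym (R : realType) (p : nat) (x : nat -> 'cV[R]_p) n :
  (sample_cov x n)^T = sample_cov x n.
Proof.
rewrite /sample_cov linearZ/= linear_sum/=; congr (_ *: _).
by apply: eq_bigr => t _; rewrite trmx_mul trmxK.
Qed.

Lemma sample_covE (R : realType) (p : nat) (x : nat -> 'cV[R]_p) n i j :
  sample_cov x n i j = n%:R^-1 * (\sum_(t < n) x t i 0 * x t j 0) -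
    (n%:R^-1 * \sum_(t < n) x t i 0) * (n%:R^-1 * \sum_(t < n) x t j 0).
Proof.
have meanE k : sample_mean x n k 0 = n%:R^-1 * \sum_(t < n) x t k 0.
  by rewrite mxE summxE.
rewrite -!meanE mxE summxE.
(* For [n = 0] the sums are empty and both sides are [0]. *)
case: n meanE => [|n] meanE.
  by rewrite !meanE !big_ord0 !mulr0 subr0.
have n0 : n.+1%:R != 0 :> R by rewrite pnatr_eq0.
set mi := sample_mean _ _ i 0; set mj := sample_mean _ _ j 0.
rewrite (eq_bigr (fun t : 'I_n.+1 => x t i 0 * x t j 0 +
    (- mj * x t i 0 + (- mi * x t j 0 + mi * mj)))); last first.
  have entryB (u v : 'cV[R]_p) k : (u - v) k 0 = u k 0 - v k 0 by rewrite !mxE.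
  by move=> t _; rewrite mxE big_ord1 [_^T _ _]mxE !entryB -/mi -/mj; ring.
rewrite !big_split/= sumr_const card_ord -!mulr_sumr -(mulr_natl (mi * mj)).
by rewrite /mi /mj !meanE; field.
Qed.

Section Covariance.
Context {R : realType} {d : measure_display} {Omega : measurableType d}.
Variables (P : probability Omega R) (p : nat) (X : Omega -> p.-tuple R).
Let x i w := tnth (X w) i.

Lemma cov_mxE i j :
  P.-integrable setT (EFin \o x i) -> P.-integrable setT (EFin \o x j) ->
  P.-integrable setT (EFin \o (fun w => x i w * x j w)) ->
  cov_mx P X i j =
    \int[P]_w (x i w * x j w) - (\int[P]_w x i w) * (\int[P]_w x j w).
Proof.
move=> ii ij iij; rewrite mxE covarianceE; [|exact/Lfun1_integrable..].
rewrite unlock fineB ?fin_numM ?integrable_fin_num//.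
by rewrite fineM ?integrable_fin_num.
Qed.

End Covariance.

Lemma natr_powRN_itv (R : realType) (x : R) (n : nat) : 0 <= x ->
  0 <= (n%:R : R) `^ (- x) <= 1.
Proof.
move=> x0; rewrite powR_ge0/=; case: n => [|n].
  have [->|xn0] := eqVneq x 0; first by rewrite oppr0 powRr0.
  by rewrite powR0 ?oppr_eq0.
by rewrite powRN invf_le1 ?powR_gt0// -[leLHS](powRr0 n.+1%:R) ler_powR ?ler1n.
Qed.

Lemma natr_powRN_small (R : realType) (x e : R) : 0 < x -> 0 < e ->
  exists N : nat, forall n, (N <= n)%N -> (n%:R : R) `^ (- x) <= e.
Proof.
move=> x0 e0; exists (Num.trunc (e^-1 `^ x^-1)).+1 => n Nn.
have ep : 0 < e^-1 `^ x^-1 by rewrite powR_gt0 ?invr_gt0.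
have np : e^-1 `^ x^-1 <= n%:R.
  by apply: le_trans (ltW (truncnS_gt _)) _; rewrite ler_nat.
rewrite powRN -[leRHS]invrK lef_pV2 ?posrE ?invr_gt0 ?powR_gt0//; last first.
  exact: lt_le_trans np.
apply: (@le_trans _ _ ((e^-1 `^ x^-1) `^ x)).
  by rewrite -powRrM mulVf ?gt_eqF// powRr1// invr_ge0 ltW.
by rewrite ge0_ler_powR ?nnegrE ?(ltW x0) ?(ltW ep).
Qed.

(** * Rates for the sample covariance and for the regret *)

Theorem proposition6p1 (R : realType) (p : nat) (kappa alpha : R)
    (Rho : 'M[R]_p)
    (* the model vector X *)
    (d0 : measure_display) (Omega0 : measurableType d0)
    (P0 : probability Omega0 R)
    (W : {RV P0 >-> R}) (Z : {RV P0 >-> p.-tuple R})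
    (* the sample X_1, X_2, ... (indexed from 0) *)
    (d : measure_display) (Omega : measurableType d) (P : probability Omega R)
    (X : nat -> {RV P >-> p.-tuple R}) :
  let X0 := skew_t_vector alpha W Z in
  let Sigma := cov_mx P0 X0 in
  let Sigmahat n w := sample_cov (fun t => col_of_tuple (X t w)) n in
  (0 < p)%N -> 2 < kappa -> kappa < 4 -> correlation_mx Rho ->
  skew_t_data kappa Rho W Z ->
  (forall t, has_law P (X t) (pushforward P0 X0)) ->
  mutually_independent P X ->
  posdefmx Sigma ->
  stoch_bigO P (fun n w => spectral_norm (Sigmahat n w - Sigma))
          (fun n => n%:R `^ (- ((kappa - 2) / kappa)))
  /\
  (forall Y : nat -> {RV P >-> R},
     (forall n w, posdefmx (Sigmahat n w) ->
        Y n w = regret Sigma (Sigmahat n w)) ->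
     stoch_bigO P Y (fun n => n%:R `^ (- (2 * (kappa - 2) / kappa)))).
Proof.
move=> X0 Sigma Sigmahat p0 kappa2 kappa4 corrRho dataWZ lawX indX Spd.
have kappa0 : 0 < kappa by apply: lt_trans kappa2.
have mX0 : measurable_fun [set: Omega0] X0 by exact: measurable_skew_t_vector.
have mX0i i : measurable_fun [set: Omega0] (fun w => tnth (X0 w) i).
  exact: measurable_skew_t_coord.
have mt i : measurable_fun [set: p.-tuple R] (fun z => tnth z i).
  exact: measurable_tnth.
have mXi t i : measurable_fun [set: Omega] (fun w => tnth (X t w) i).
  exact: (measurableT_comp (mt i)).
have [C C0 tailX0] := skew_t_coord_tail alpha kappa2 kappa4 corrRho dataWZ.
have a1 : 1 < kappa / 2 by lra.
have a2 : kappa / 2 < 2 by lra.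
pose x := (kappa - 2) / kappa.
have x0 : 0 < x by rewrite divr_gt0// subr_gt0.
pose r (n : nat) : R := n%:R `^ (- x).
have r01 n : 0 <= r n <= 1 by apply: natr_powRN_itv; exact: ltW.
have r0 n : 0 <= r n by case/andP: (r01 n).
(* The weak-law exponent at tail index [kappa / 2] is the exponent of the theorem. *)
have xE : 1 - (kappa / 2)^-1 = x by rewrite /x; field; rewrite gt_eqF.
pose m i := \int[P0]_w tnth (X0 w) i.
pose D1 i n w := n%:R^-1 * (\sum_(t < n) tnth (X t w) i) - m i.
pose D2 i j n w := n%:R^-1 * (\sum_(t < n) tnth (X t w) i * tnth (X t w) j) -
   \int[P0]_w (tnth (X0 w) i * tnth (X0 w) j).
have [int1 O1] : (forall i,
    P0.-integrable setT (EFin \o (fun w => tnth (X0 w) i))) /\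
    forall i, stoch_bigO P (D1 i) r.
  have H i := iid_mean_bigO mX0 lawX indX (mt i) a1 a2 (addr_ge0 C0 ler01)
    (tail_bound_half (mX0i i) kappa0 C0 (tailX0 i)).
  rewrite xE in H.
  by split=> i; have [] := H i.
have [int2 O2] : (forall i j, P0.-integrable setT
    (EFin \o (fun w => tnth (X0 w) i * tnth (X0 w) j))) /\
    forall i j, stoch_bigO P (D2 i j) r.
  have H i j := iid_mean_bigO mX0 lawX indX (measurable_funM (mt i) (mt j))
    a1 a2 (mulr_ge0 (ler0n _ 2) C0)
    (tail_bound_mul (mX0i i) (mX0i j) (tailX0 i) (tailX0 j)).
  rewrite xE in H.
  by split=> i j; have [] := H i j.
pose Err n w := Sigmahat n w - Sigma.
(* The product of the two sample means is expanded around [m i * m j]: besides terms linear in [D1]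
   and [D2], only the product [D1 i * D1 j] remains. *)
have ErrE i j n w : Err n w i j =
    D2 i j n w + (-1 * (D1 i n w * D1 j n w) +
      (- m i * D1 j n w + - m j * D1 i n w)).
  have entryB (A B : 'M[R]_p) : (A - B) i j = A i j - B i j by rewrite !mxE.
  rewrite /Err entryB sample_covE.
  rewrite [Sigma _ _](cov_mxE (int1 i) (int1 j) (int2 i j)) -/(m i) -/(m j).
  rewrite (eq_bigr (fun t : 'I_n => tnth (X t w) i * tnth (X t w) j)); last first.
    by move=> t _; rewrite !mxE.
  have sumE k : \sum_(t < n) col_of_tuple (X t w) k 0 = \sum_(t < n) tnth (X t w) k.
    by apply: eq_bigr => t _; rewrite mxE.
  by rewrite !sumE /D2 /D1; ring.
have mD1 i n : measurable_fun [set: Omega] (D1 i n).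
  apply: measurable_funB => //; apply: measurable_funM => //.
  exact: measurable_sum.
have mD2 i j n : measurable_fun [set: Omega] (D2 i j n).
  apply: measurable_funB => //; apply: measurable_funM => //.
  by apply: measurable_sum => t; exact: measurable_funM.
have mD11 i j n : measurable_fun [set: Omega] (fun w => D1 i n w * D1 j n w).
  exact: measurable_funM.
have mcD11 i j n :
    measurable_fun [set: Omega] (fun w => -1 * (D1 i n w * D1 j n w)).
  exact: measurable_funM.
have mcD1 (c : R) i n : measurable_fun [set: Omega] (fun w => c * D1 i n w).
  exact: measurable_funM.
have mlin i j n : measurable_fun [set: Omega]
    (fun w => - m i * D1 j n w + - m j * D1 i n w).
  by apply: measurable_funD; exact: mcD1.
have mtail i j n : measurable_fun [set: Omega]
    (fun w => -1 * (D1 i n w * D1 j n w) +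
      (- m i * D1 j n w + - m j * D1 i n w)).
  by apply: measurable_funD; [exact: mcD11|exact: mlin].
have mErr i j n : measurable_fun [set: Omega] (fun w => Err n w i j).
  by under eq_fun do rewrite ErrE; apply: measurable_funD.
have OErr i j : stoch_bigO P (fun n w => Err n w i j) r.
  rewrite (_ : (fun n w => _) = fun n w => D2 i j n w +
      (-1 * (D1 i n w * D1 j n w) + (- m i * D1 j n w + - m j * D1 i n w))).
    apply: (stoch_bigOD (mD2 i j) (mtail i j) r0 (O2 i j)).
    apply: (stoch_bigOD (mcD11 i j) (mlin i j) r0).
      apply: (stoch_bigOZ _ (mD11 i j) r0).
      exact: (stoch_bigOM (mD1 i) (mD1 j) r01 (O1 i) (O1 j)).
    apply: (stoch_bigOD (mcD1 _ j) (mcD1 _ i) r0).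
      exact: (stoch_bigOZ _ (mD1 j) r0 (O1 j)).
    exact: (stoch_bigOZ _ (mD1 i) r0 (O1 i)).
  by apply/funext => n; apply/funext => w; exact: ErrE.
(* This one scalar sequence dominates both quantities of the theorem; it serves as both inputs of
   [stoch_bigO_dominated]. *)
pose N n w := entry_norm (Err n w).
have mabsErr i j n : measurable_fun [set: Omega] (fun w => `|Err n w i j|).
  exact: (measurableT_comp (@normr_measurable _ _) (mErr i j n)).
have mrow i n : measurable_fun [set: Omega] (fun w => \sum_j `|Err n w i j|).
  by apply: measurable_sum => j; exact: mabsErr.
have mN n : measurable_fun [set: Omega] (N n).
  by apply: measurable_sum => i; exact: mrow.
have ON : stoch_bigO P N r.
  apply: (stoch_bigO_sum _ mrow r0) => i.
  by apply: (stoch_bigO_sum _ (mabsErr i) r0) => j; exact: stoch_bigO_normr.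
have N0 n w : 0 <= N n w by exact: entry_norm_ge0.
split.
  apply: (stoch_bigO_dominated mN mN _ r0 _ ON ON) => [n c c0|M1 M2].
    by apply: measurable_spectral_norm_gt => // i j; exact: mErr.
  exists M1, 0%N => n w _ NM _; rewrite ger0_norm ?spectral_norm_ge0//.
  apply: le_trans (spectral_norm_le _) _.
  by apply: le_trans (ler_norm _) NM.
move=> Y YE.
have rE n : n%:R `^ (- (2 * (kappa - 2) / kappa)) = r n ^+ 2.
  rewrite -powR_mulrn// -powRrM; congr (_ `^ _).
  by rewrite /x; ring.
apply: (stoch_bigO_dominated mN mN _ _ _ ON ON) => [n c _|n|M1 M2].
- exact: measurable_gt_norm.
- exact: powR_ge0.
have V0 : 0 <= inv_trace Sigma.
  by have [] := sqr_coord_le_qform 0 (Ordinal p0) Spd.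
(* From [n0] on, [r n <= 1 / (2 K)], so on the event [N <= M1 * r] the error satisfies the smallness
   condition of the perturbation bounds; the [+ 1] keeps [K] positive. *)
pose K := `|M1| * inv_trace Sigma + 1.
have K0 : 0 < K by rewrite ltr_wpDl// mulr_ge0.
have e0 : 0 < 2^-1 / K by rewrite divr_gt0// invr_gt0.
have [n0 rsmall] := natr_powRN_small x0 e0.
exists (4 * inv_trace Sigma * enorm (gmv Sigma) ^+ 2 * M1 ^+ 2), n0.
move=> n w nn0; rewrite (ger0_norm (N0 n w)) => NM _.
have Esym : (Err n w)^T = Err n w.
  by case: Spd => St _; rewrite /Err linearB/= St sample_cov_sym.
have SE : Sigma + Err n w = Sigmahat n w by rewrite subrKC.
have small : entry_norm (Err n w) * inv_trace Sigma <= 2^-1.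
  apply: (@le_trans _ _ (r n * K)); last by rewrite -ler_pdivlMr//; exact: rsmall.
  apply: (@le_trans _ _ (`|M1| * r n * inv_trace Sigma)).
    rewrite ler_wpM2r//; apply: le_trans NM _.
    by rewrite ler_wpM2r// ler_norm.
  by rewrite mulrAC mulrC ler_wpM2l// /K lerDl.
(* On this event the sample covariance is positive definite, so [Y] is the regret; its values
   elsewhere are arbitrary. *)
rewrite (YE n w); last by rewrite -SE; exact: posdefmx_perturb.
have /andP[reg0 regle] := regret_perturb p0 Spd Esym small.
rewrite -SE ger0_norm// rE; apply: le_trans regle _.
rewrite -[leRHS]mulrA -exprMn ler_wpM2l//.
  by rewrite mulr_ge0 ?sqr_ge0// mulr_ge0.
by rewrite lerXn2r ?nnegrE// ?N0// (le_trans (N0 n w) NM).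
Qed.
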